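(* Let $\mathcal H$ be a separable real Hilbert space, let $\mathbf A,\mathbf B\in\mathcal B_1^+(\mathcal H)$ with $\mathbf A\leadsto\mathbf B$, and put $\mathcal H_1=\overline{\mathcal R(\mathbf A)}$, $\mathcal H_2=\mathcal N(\mathbf A)$. Then the set of all operators $\mathbf M\in\mathcal G(\mathbf B)$ satisfying $\mathbf A^{1/2}\mathbf M\succeq\mathbf 0$ is the set of all $$\mathbf M=\begin{pmatrix}\mathbf A_{11}^{\dagger/2}(\mathbf A_{11}^{1/2}\mathbf B_{11}\mathbf A_{11}^{1/2})^{1/2}&\mathbf 0\\ [(\mathbf A_{11}^{1/2}\mathbf B_{11}\mathbf A_{11}^{1/2})^{\dagger/2}\mathbf A_{11}^{1/2}\mathbf B_{12}+\mathbf N_{12}]^{*}&\mathbf M_{22}\end{pmatrix}:\mathcal H_1\oplus\mathcal H_2\to\mathcal H_1\oplus\mathcal H_2,$$ where - $\mathbf N_{12}:\mathcal H_2\to\mathcal H_1$ satisfies $\mathcal R(\mathbf N_{12})\subset\mathcal N(\mathbf B_{11}^{1/2}\mathbf A_{11}^{1/2})$ and $\mathbf N_{12}^*\mathbf N_{12}\preceq\mathbf B/\mathbf A$; - $\mathbf M_{22}:\mathcal H_2\to\mathcal H_2$ satisfies $\mathbf M_{22}\mathbf M_{22}^*=\mathbf B/\mathbf A-\mathbf N_{12}^*\mathbf N_{12}$. Such a solution corresponds to a Monge map (i.e. $\mathbf M=\mathbf T\mathbf A^{1/2}$ for some optimal pre-pushforward $\mathbf T:\mathcal R(\mathbf A^{1/2})\subset\mathcal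 H_1\to\mathcal H$ from $\mathbf A$ to $\mathbf B$) if and only if $\mathbf M_{22}=\mathbf 0$ (i.e. $\mathbf N_{12}^*\mathbf N_{12}=\mathbf B/\mathbf A$).
   Context: $\mathcal N(\cdot)$ and $\mathcal R(\cdot)$ denote null space and range. $\mathcal B_1^+(\mathcal H)$ is the set of self-adjoint positive semidefinite trace-class operators. $\mathbf C\succeq\mathbf 0$ means bounded, self-adjoint and positive semidefinite. $\mathcal G(\mathbf B)$ is the set of Green's operators of $\mathbf B$, i.e. compact operators $\mathbf M$ on $\mathcal H$ with $\mathbf M\mathbf M^*=\mathbf B$. $^\dagger$ is the Moore–Penrose pseudoinverse (defined on $\mathcal R(\mathbf K)\oplus\mathcal R(\mathbf K)^\perp$, with range $\mathcal N(\mathbf K)^\perp$), and $\mathbf C^{\dagger/2}:=(\mathbf C^{1/2})^\dagger$. Optimal pre-pushforward from $\mathbf A$ to $\mathbf B$: a (possibly unbounded) linear operator $\mathbf T:\mathcal R(\mathbf A^{1/2})\subset\mathcal H_1\to\mathcal H$ with $(\mathbf T\mathbf A^{1/2})(\mathbf T\mathbf A^{1/2})^*=\mathbf B$ and $\operatorname{tr}(\mathbf A^{1/2}\mathbf T\mathbf A^{1/2})=\operatorname{tr}(\mathbf T\mathbf A)=\operatorname{tr}[(\mathbf A^{1/2}\mathbf B\mathbf A^{1/2})^{1/2}]$. Write $\mathbf A\leadsto\mathbf B$ if one exists. Block notation: with $\boldsymbol\Pi_i$ the orthogonal projection onto $\mathcal H_i$, $\mathbf A_{11}=\mathbf A|_{\mathcal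 H_1}$, $\mathbf B_{ij}=\boldsymbol\Pi_i\mathbf B|_{\mathcal H_j}$. Schur complement: $\mathbf B/\mathbf A:=\mathbf B_{22}-(\mathbf B_{11}^{\dagger/2}\mathbf B_{12})^*(\mathbf B_{11}^{\dagger/2}\mathbf B_{12}):\mathcal H_2\to\mathcal H_2$ (well defined since $\mathcal R(\mathbf B_{12})\subset\mathcal R(\mathbf B_{11}^{1/2})$). *)

(* Defs.v *)
From HB Require Import structures.
From mathcomp Require Import all_boot all_order all_algebra.
From mathcomp Require Import all_classical all_reals all_analysis.

Set Implicit Arguments.
Unset Strict Implicit.
Unset Printing Implicit Defensive.

Import Order.TTheory GRing.Theory Num.Theory.
Import numFieldNormedType.Exports.

Local Open Scope classical_set_scope.
Local Open Scope ring_scope.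

HB.mixin Record CompleteNormedModule_isHilbert (R : realType) H
    & CompleteNormedModule R H := {
  inner : H -> H -> R ;
  innerC : forall x y, inner x y = inner y x ;
  innerDl : forall x y z, inner (x + y) z = inner x z + inner y z ;
  innerZl : forall (a : R) x y, inner (a *: x) y = a * inner x y ;
  inner_normE : forall x, inner x x = `|x| ^+ 2 }.

#[short(type="hilbertType")]
HB.structure Definition Hilbert (R : realType) :=
  { H of CompleteNormedModule R H & CompleteNormedModule_isHilbert R H }.

Section InnerDot.
Context (R : realType) (H : hilbertType R).

Let inner_bilinear :
  bilinear_for (@GRing.mul R) (idfun \; @GRing.mul R) (@inner R H).
Proof.
split=> u a x y /=; first by rewrite innerDl innerZl.
by rewrite innerC innerDl innerZl ![inner _ u]innerC.
Qed.

Let inner_sym (x y : H) : inner x y = (-1) ^+ false * idfun (inner y x).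
Proof. by rewrite expr0 mul1r innerC. Qed.

Let inner_gt0 (x : H) : x != 0 -> 0 < inner x x.
Proof. by rewrite inner_normE => x0; rewrite exprn_gt0// normr_gt0. Qed.

HB.instance Definition _ :=
  bilinear_isBilinear.Build R H H R (@GRing.mul R) (idfun \; @GRing.mul R)
    (@inner R H) inner_bilinear.
HB.instance Definition _ :=
  @isHermitianSesquilinear.Build R H false idfun (@inner R H) inner_sym.
HB.instance Definition _ := @isDotProduct.Build R H (@inner R H) inner_gt0.

End InnerDot.

Definition separable_space (T : topologicalType) : Prop :=
  exists2 D : set T, countable D & dense D.

Record closedSubspace (R : realType) (H : hilbertType R) := ClosedSubspace {
  carrier : set H ;
  carrier0 : carrier 0 ;
  carrierDZ : forall (a : R) x y,
    carrier x -> carrier y -> carrier (a *: x + y) ;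
  carrier_closed : closed carrier }.

Definition subspace_sort (R : realType) (H : hilbertType R)
  (W : closedSubspace H) : Type := {x : H | x \in carrier W}.
Coercion subspace_sort : closedSubspace >-> Sortclass.

Section SubspaceHilbert.
Context (R : realType) (H : hilbertType R) (W : closedSubspace H).

HB.instance Definition _ := SubChoice.on (subspace_sort W).

Let mem_carrier_submod : submod_closed [pred x | x \in carrier W].
Proof.
split=> [|a x y]; rewrite !inE; first exact: carrier0.
exact: carrierDZ.
Qed.

HB.instance Definition _ := GRing.SubChoice_isSubLmodule.Build R H _
  (subspace_sort W) mem_carrier_submod.

Let subnorm (x : subspace_sort W) : R := `|val x|.

Let subnormD x y : subnorm (x + y) <= subnorm x + subnorm y.
Proof. exact: ler_normD. Qed.

Let subnormZ (l : R) x : subnorm (l *: x) = `|l| * subnorm x.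
Proof. exact: normrZ. Qed.

Let subnorm0_eq0 x : subnorm x = 0 -> x = 0.
Proof. by move=> /normr0_eq0 x0; apply/val_inj; rewrite x0. Qed.

HB.instance Definition _ := Lmodule_isNormed.Build R (subspace_sort W)
  subnormD subnormZ subnorm0_eq0.

Lemma subspace_normE (x : W) : `|x| = `|val x|.
Proof. by []. Qed.

Let sub_complete (F : set_system (subspace_sort W)) :
  ProperFilter F -> cauchy F -> cvg F.
Proof.
move=> FF /cauchy_ballP Fc.
pose G : set_system H := (val : W -> H) @ F.
have Gc : cauchy G.
  apply/cauchy_ballP => e e0; have := Fc e e0.
  case=> -[P Q] /= [FP FQ] PQ.
  exists (val @` P, val @` Q) => /=.
    by split; [apply: filterS FP|apply: filterS FQ] => x Px /=; exists x.
  case=> _ _ /= [[x Px <-] [y Qy <-]].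
  by have := PQ (x, y) (conj Px Qy); rewrite -!ball_normE /= subspace_normE.
have /cauchy_cvg Gl := Gc.
have Wl : carrier W (lim G).
  have Wcl : closure (carrier W) `<=` carrier W := @carrier_closed _ _ W.
  apply: Wcl => B Bl.
  have FB : F (val @^-1` B) by exact: Gl.
  have [x Bx] := filter_ex FB.
  by exists (val x); split => //; exact/set_mem/(valP x).
pose l : W := exist _ (lim G) (mem_set Wl).
apply/cvg_ex; exists l; apply/cvgrPdist_lt => e e0.
have /cvgrPdist_lt /(_ e e0) := Gl.
exact.
Qed.

HB.instance Definition _ :=
  Uniform_isComplete.Build (subspace_sort W) sub_complete.

Let subinner (x y : W) : R := inner (val x) (val y).

HB.instance Definition _ :=
  CompleteNormedModule_isHilbert.Build R (subspace_sort W)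
    (inner := subinner)
    (fun x y => innerC (val x) (val y))
    (fun x y z => innerDl (val x) (val y) (val z))
    (fun a x y => innerZl a (val x) (val y))
    (fun x => inner_normE (val x)).

Lemma subspace_innerE (x y : W) : inner x y = inner (val x) (val y).
Proof. by []. Qed.

End SubspaceHilbert.

Section Operators.
Context (R : realType).
Implicit Types H K : hilbertType R.

Definition bounded_op H K (T : H -> K) : Prop := linear T /\ continuous T.

Definition nullspace H K (T : H -> K) : set H := T @^-1` [set 0].

(* The default value 0 is only reached by operators without an adjoint defined
   on all of K, hence never by bounded operators between Hilbert spaces. *)
Definition adj H K (T : H -> K) : K -> H :=
  xget 0 [set S : K -> H | forall x y, inner (T x) y = inner x (S y)].

Definition psd H (T : H -> H) : Prop :=
  [/\ bounded_op T,
      forall x y, inner (T x) y = inner x (T y)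
    & forall x, 0 <= inner (T x) x].

(* Meaningful for psd C only, when the psd square root exists and is unique. *)
Definition sqrtop H (C : H -> H) : H -> H :=
  xget 0 [set S : H -> H | psd S /\ S \o S = C].

(* On range K (+) (range K)^\bot, pseudoinv K y is the unique x orthogonal to
   nullspace K such that K x is the component of y in range K; elsewhere there is
   no such x and the value 0 is meaningless. *)
Definition pseudoinv H K (T : H -> K) (y : K) : H :=
  xget 0 [set x | (forall z, nullspace T z -> inner x z = 0) /\
                  (forall z, inner (y - T x) (T z) = 0)].

Definition compact_op H K (T : H -> K) : Prop :=
  linear T /\ precompact (T @` [set x | `|x| <= 1]).

(* Orthonormal bases are unordered, so as to cover finite and infinite
   dimension together. *)
Definition orthonormal_basis H (E : set H) : Prop :=
  [/\ forall e, E e -> inner e e = 1,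
      forall e f, E e -> E f -> e != f -> inner e f = 0
    & forall x, (forall e, E e -> inner x e = 0) -> x = 0].

Definition trace_class H (T : H -> H) : Prop :=
  bounded_op T /\
  exists2 E : set H, orthonormal_basis E &
    (\esum_(e in E) (inner (sqrtop (adj T \o T) e) e)%:E < +oo)%E.

Definition has_trace H (T : H -> H) (t : R) : Prop :=
  trace_class T /\
  forall E : set H, orthonormal_basis E ->
    (let d (e : H) := (inner (T e) e)%:E in
     \esum_(e in E) d^\+ e - \esum_(e in E) d^\- e = t%:E)%E.

Definition trace_class_psd H (T : H -> H) : Prop := psd T /\ trace_class T.

Definition green H (B M : H -> H) : Prop :=
  compact_op M /\ M \o adj M = B.

Definition linear_on H K (D : set H) (T : H -> K) : Prop :=
  forall (a : R) x y, D x -> D y -> T (a *: x + y) = a *: T x + T y.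

(* T is a possibly unbounded operator with domain range (sqrtop A); its values
   outside of this domain are irrelevant. Boundedness of T \o sqrtop A, without
   which adj is meaningless, is part of the meaning of the factorization of B. *)
Definition optimal_prepushforward H (A B : H -> H) (T : H -> H) : Prop :=
  [/\ linear_on (range (sqrtop A)) T,
      bounded_op (T \o sqrtop A),
      (T \o sqrtop A) \o adj (T \o sqrtop A) = B
    & exists t : R, [/\ has_trace (sqrtop A \o T \o sqrtop A) t,
                        has_trace (T \o A) t
                      & has_trace (sqrtop (sqrtop A \o B \o sqrtop A)) t]].

Definition reachable H (A B : H -> H) : Prop :=
  exists T, optimal_prepushforward A B T.

End Operators.

Section Blocks.
Context (R : realType) (H : hilbertType R).
Implicit Types U V W : closedSubspace H.

Definition oproj W (x : H) : W :=
  xget 0 [set p : W | forall w : W, inner (x - val p) (val w) = 0].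
Arguments oproj : clear implicits.

(* The compression of T to an operator V -> U. If range T is included in U,
   then block U U T is the restriction of T to U. *)
Definition block U V (T : H -> H) : V -> U :=
  fun x => oproj U (T (val x)).
Arguments block : clear implicits.

Definition of_blocks U V (M11 : U -> U) (M12 : V -> U) (M21 : U -> V)
    (M22 : V -> V) : H -> H :=
  fun x => val (M11 (oproj U x) + M12 (oproj V x)) +
           val (M21 (oproj U x) + M22 (oproj V x)).

Definition schur U V (B : H -> H) : V -> V :=
  let C : V -> U := pseudoinv (sqrtop (block U U B)) \o block U V B in
  block V V B - (adj C \o C).
Arguments schur : clear implicits.

(* An operator V -> U is understood to be linear and bounded. *)
Definition admissible U V (A B : H -> H) (N12 : V -> U) (M22 : V -> V) : Prop :=
  let A11 := block U U A in
  let B11 := block U U B in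
  let S := schur U V B in
  [/\ bounded_op N12,
      range N12 `<=` nullspace (sqrtop B11 \o sqrtop A11),
      psd (S - (adj N12 \o N12)),
      bounded_op M22
    & M22 \o adj M22 = S - (adj N12 \o N12)].

Definition solution U V (A B : H -> H) (N12 : V -> U) (M22 : V -> V) : H -> H :=
  let A11 := block U U A in
  let B11 := block U U B in
  let B12 := block U V B in
  let G := sqrtop A11 \o B11 \o sqrtop A11 in
  of_blocks (pseudoinv (sqrtop A11) \o sqrtop G) 0
            (adj ((pseudoinv (sqrtop G) \o sqrtop A11 \o B12) + N12)) M22.

End Blocks.

Arguments oproj {R H} W x.
Arguments block {R H} U V T.
Arguments schur {R H} U V B.

(* Main.v *)
(* The equation M M^* = B together with A^(1/2) M >= 0 forces A^(1/2) M to be the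
   positive square root of A^(1/2) B A^(1/2), which vanishes on H2 = N(A). Hence
   M12 = 0, the entry M11 is determined by cancelling the injective operator
   A11^(1/2), and D = M21^* solves G^(1/2) D = A11^(1/2) B12 with
   G = A11^(1/2) B11 A11^(1/2). Its solutions are D0 + N12, where D0 is the one
   given by the pseudoinverse and N12 takes its values in N(G^(1/2)). Both D0 and
   B11^(+/2) B12 represent the same functional with respect to two seminorms that
   agree through the dense range of A11^(1/2), so D0^* D0 is the term subtracted
   in the Schur complement, and M21 M21^* + M22 M22^* = B22 becomes the condition
   on M22. Compactness of M and the trace conditions are automatic, because A^(1/2)
   and M are Hilbert-Schmidt. *)

Require Import Defs.
From mathcomp Require Import all_boot all_order all_algebra.
From mathcomp Require Import all_classical all_reals all_analysis.
From mathcomp Require Import ring lra.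

Set Implicit Arguments.
Unset Strict Implicit.
Unset Printing Implicit Defensive.

Import Order.TTheory GRing.Theory Num.Theory.
Import numFieldNormedType.Exports.

Local Open Scope classical_set_scope.
Local Open Scope ring_scope.

(** Existence comes from two constructions only. One is the minimisation in [riesz_seminorm]: a
    functional dominated by c |S v| is represented by a vector of norm at most c in the closure of
    range S. It yields adjoints, projections, pseudoinverses and Douglas factorisation. The other is
    a monotone iteration for square roots. The obstacle is that A11^(1/2) is injective but in
    general not onto, so the pseudoinverses are unbounded. They are only applied after an F with |<F
    u, x>| <= c |u| |S x|, which makes S^+ F bounded and gives S S^+ F = F. These bounds rest on
    |G^(1/2) x| = |B11^(1/2) A11^(1/2) x| and on the positivity of B. A11^(1/2) is then cancelled on
    the left by injectivity and on the right by symmetry. The traces agree because each operator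
    involved is a product X^* Y of Hilbert-Schmidt operators. Polarisation expresses its trace by
    Hilbert-Schmidt norms, which depend neither on the basis nor on passing to adjoints. A solution
    M is of the form T A^(1/2) exactly when it vanishes on N(A^(1/2)) = H2; since M12 = 0 already,
    only M22 matters. *)

Lemma discr_le (R : realFieldType) (a b c : R) :
  (forall t, 0 <= a + 2 * t * b + t ^+ 2 * c) -> b ^+ 2 <= a * c.
Proof.
move=> q; have a0 : 0 <= a by have := q 0; rewrite mulr0 mul0r expr0n mul0r !addr0.
have [c0|c0|c0] := ltgtP c 0.
(* Adding the hypothesis at t and - t cancels the linear term and leaves t^2 (- c) <= a. The summand
   1 gives t >= 1, hence t^2 (- c) >= (t - 1) (- c) > a. *)
- exfalso; pose t := (a + 1 + b ^+ 2) / (- c) + 1.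
  have t1 : 1 <= t by rewrite ler_wpDl// divr_ge0//; nra.
  have h : (t - 1) * (- c) = a + 1 + b ^+ 2 by rewrite /t; field; lra.
  have := q t; have := q (- t); nra.
- have := q (- b / c); have -> : a + 2 * (- b / c) * b + (- b / c) ^+ 2 * c =
    (a * c - b ^+ 2) / c by field; lra.
  by rewrite pmulr_lge0 ?invr_gt0// subr_ge0.
- rewrite c0 mulr0; have [->|b0] := eqVneq b 0; first by rewrite expr0n.
  exfalso; have := q (- (a + 1) / (2 * b)); rewrite c0 mulr0 addr0.
  have -> : a + 2 * (- (a + 1) / (2 * b)) * b = - 1 by field.
  lra.
Qed.

Lemma lt_of_sqr_lt (R : realFieldType) (a b : R) : 0 <= b -> a ^+ 2 < b ^+ 2 -> a < b.
Proof. by move=> b0 ab; rewrite ltNge; apply/negP => ba; nra. Qed.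

Lemma le_of_sqr_le (R : realFieldType) (a b : R) : 0 <= b -> a ^+ 2 <= b ^+ 2 -> a <= b.
Proof. by move=> b0 ab; rewrite leNgt; apply/negP => ba; nra. Qed.

Lemma eq0_le_eps (R : realFieldType) (x : R) :
  (forall e : R, 0 < e -> `|x| <= e) -> x = 0.
Proof.
move=> h; apply/eqP; rewrite -normr_le0 leNgt; apply/negP => x0.
by have := h (`|x| / 2) (divr_gt0 x0 (ltr0n _ 2)); lra.
Qed.

(** * Representation of functionals *)

Section InnerTheory.
Context (R : realType) (H : hilbertType R).
Implicit Types x y z : H.

Lemma innerDr x y z : inner x (y + z) = inner x y + inner x z.
Proof. by rewrite innerC innerDl !(innerC x). Qed.

Lemma innerZr (a : R) x y : inner x (a *: y) = a * inner x y.
Proof. by rewrite innerC innerZl (innerC x). Qed.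

Lemma innerNl x y : inner (- x) y = - inner x y.
Proof. by rewrite -scaleN1r innerZl mulN1r. Qed.

Lemma innerNr x y : inner x (- y) = - inner x y.
Proof. by rewrite -scaleN1r innerZr mulN1r. Qed.

Lemma innerBl x y z : inner (x - y) z = inner x z - inner y z.
Proof. by rewrite innerDl innerNl. Qed.

Lemma innerBr x y z : inner x (y - z) = inner x y - inner x z.
Proof. by rewrite innerDr innerNr. Qed.

Lemma inner0l x : inner 0 x = 0.
Proof. by rewrite -(scale0r 0) innerZl mul0r. Qed.

Lemma inner0r x : inner x 0 = 0.
Proof. by rewrite innerC inner0l. Qed.

Lemma inner_ge0 x : 0 <= inner x x.
Proof. by rewrite inner_normE exprn_ge0. Qed.

Lemma inner_eq0 x : inner x x = 0 -> x = 0.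
Proof. by rewrite inner_normE => /eqP; rewrite sqrf_eq0 normr_eq0 => /eqP. Qed.

Lemma inner_ext x y : (forall z, inner x z = inner y z) -> x = y.
Proof.
move=> h; apply/eqP; rewrite -subr_eq0; apply/eqP/inner_eq0.
by rewrite innerBl h subrr.
Qed.

Lemma sqr_normB x y : `|x - y| ^+ 2 = `|x| ^+ 2 - 2 * inner x y + `|y| ^+ 2.
Proof. by rewrite -!inner_normE innerBl !innerBr (innerC y x); ring. Qed.

Lemma sqr_normD x y : `|x + y| ^+ 2 = `|x| ^+ 2 + 2 * inner x y + `|y| ^+ 2.
Proof. by rewrite -!inner_normE innerDl !innerDr (innerC y x); ring. Qed.

Lemma cauchy_schwarz x y : `|inner x y| <= `|x| * `|y|.
Proof.
rewrite -(@ler_pXn2r _ 2)// ?nnegrE ?mulr_ge0// exprMn.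
rewrite [X in X <= _]real_normK ?num_real// -!inner_normE.
apply: discr_le => t; suff -> : inner x x + 2 * t * inner x y + t ^+ 2 * inner y y
  = inner (x + t *: y) (x + t *: y) by exact: inner_ge0.
by rewrite innerDl !innerDr !innerZl !innerZr (innerC y x); ring.
Qed.

Lemma inner_le x y : inner x y <= `|x| * `|y|.
Proof. exact: le_trans (ler_norm _) (cauchy_schwarz x y). Qed.

Lemma closure_normP (D : set H) x :
  closure D x <-> forall e : R, 0 < e -> exists2 d, D d & `|x - d| < e.
Proof.
split=> [cl e e0|h].
  have [d [Dd bd]] := cl _ (nbhsx_ballx x e e0).
  by exists d => //; move: bd; rewrite -ball_normE.
move=> B /nbhs_ballP[e /= e0 eB]; have [d Dd xd] := h e e0.
by exists d; split=> //; apply: eB; rewrite -ball_normE.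
Qed.

Lemma cauchy_seq_cvg (u : nat -> H) :
  (forall e : R, 0 < e -> exists N, forall m n, (N <= m)%N -> (N <= n)%N ->
     `|u m - u n| < e) ->
  exists l, forall e : R, 0 < e -> exists N, forall n, (N <= n)%N -> `|l - u n| < e.
Proof.
move=> uC; have : cauchy (u @ \oo).
  apply/cauchy_ballP => e e0; have [N hN] := uC e e0.
  exists ([set x | exists2 n, (N <= n)%N & x = u n],
          [set x | exists2 n, (N <= n)%N & x = u n]) => /=.
    by split; exists N => // n /= Nn; exists n.
  by move=> [x y] /= [[m Nm ->] [n Nn ->]]; rewrite -ball_normE; exact: hN.
move=> /cauchy_cvg /cvg_ex[l /cvgrPdist_lt ul]; exists l => e e0.
by have [N _ hN] := ul e e0; exists N => n Nn; exact: hN.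
Qed.

End InnerTheory.

(** Testing against an arbitrary vector turns an identity between vectors into one between
    scalars. *)
Ltac inner_ring :=
  let z := fresh "z" in
  apply: inner_ext => z;
  rewrite ?(innerDl, innerBl, innerNl, innerZl, inner0l); field.

Section Riesz.
Context (R : realType) (V : lmodType R) (H : hilbertType R).

(* w minimises v |-> |S v|^2 - 2 f v over the completion of range S. *)
Lemma riesz_seminorm (S : V -> H) (f : V -> R) (c : R) :
  0 <= c -> linear S -> (forall a u v, f (a *: u + v) = a * f u + f v) ->
  (forall v, `|f v| <= c * `|S v|) ->
  exists w, [/\ closure (range S) w, (forall v, f v = inner w (S v)) & `|w| <= c].
Proof.
move=> c0 linS linf bf.
pose J v := `|S v| ^+ 2 - 2 * f v.
have JDZ u h t : J (u + t *: h) =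
    J u + 2 * t * (inner (S u) (S h) - f h) + t ^+ 2 * `|S h| ^+ 2.
  rewrite /J [u + _]addrC linS linf sqr_normD normrZ exprMn real_normK ?num_real//.
  by rewrite innerZl (innerC (S u)); ring.
(* Parallelogram law at the midpoint of u and v: since J is at least m there, S maps minimising
   sequences to Cauchy sequences. *)
have Jmid u v : `|S u - S v| ^+ 2 = 2 * J u + 2 * J v - 4 * J (u + 2^-1 *: (v - u)).
  have -> : v - u = (- 1) *: u + v by rewrite scaleN1r addrC.
  rewrite JDZ linS linf scaleN1r [- S u + S v]addrC /J !sqr_normB innerBr.
  by rewrite -(inner_normE (S u)) (innerC (S v)); lra.
have Jlb v : - c ^+ 2 <= J v.
  have := bf v; have := ler_norm (f v); have := sqr_ge0 (`|S v| - c).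
  by rewrite /J; nra.
have J_inf : has_inf (range J).
  by split; [exists (J 0); exists 0|exists (- c ^+ 2) => _ [v _ <-]].
pose m := inf (range J).
have mJ v : m <= J v by apply: ge_inf; [exact: J_inf.2|exists v].
have [r r0 rs] : exists2 r : nat -> R, (forall n, 0 < r n) &
    forall e, 0 < e -> exists N, forall n, (N <= n)%N -> r n < e.
  exists (fun n => n.+1%:R^-1) => [n|e e0]; first by rewrite invr_gt0.
  have [N _ hN] := near_infty_natSinv_lt (PosNum e0).
  by exists N => n /hN.
have ex n : exists v, J v < m + r n.
  have [_ [v _ <-] h] : exists2 x, range J x & x < m + r n.
    exact: inf_adherent.
  by exists v.
have [u hu] := choice ex.
have udist p q : `|S (u p) - S (u q)| ^+ 2 <= 2 * r p + 2 * r q.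
  rewrite Jmid; have := hu p; have := hu q.
  by have := mJ (u p + 2^-1 *: (u q - u p)); lra.
have [w hw] : exists l, forall e : R, 0 < e -> exists N, forall n, (N <= n)%N ->
    `|l - S (u n)| < e.
  apply: cauchy_seq_cvg => e e0.
  have [N hN] := rs (e ^+ 2 / 4) (divr_gt0 (exprn_gt0 2 e0) (ltr0n _ 4)).
  exists N => p q /hN hp /hN hq; apply: lt_of_sqr_lt; first exact: ltW.
  by apply: le_lt_trans (udist p q) _; lra.
have cw : closure (range S) w.
  apply/closure_normP => e e0; have [N hN] := hw e e0.
  by exists (S (u N)); [exists (u N)|exact: hN].
have fw v : f v = inner w (S v).
  apply/eqP; rewrite -subr_eq0 -oppr_eq0 opprB; apply/eqP/eq0_le_eps => e e0.
  pose k := 1 + `|S v|; have k0 : 0 < k by rewrite /k ltr_wpDr.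
  have ek0 : 0 < e / (2 * k) by rewrite divr_gt0// mulr_gt0.
  have [N1 h1] := hw _ ek0; have [N2 h2] := rs _ (exprn_gt0 2 ek0).
  pose n := maxn N1 N2; pose b := inner (S (u n)) (S v) - f v.
  (* As [u n] minimises J up to [r n], the quadratic r n + 2 t b + t^2 |S v|^2 is nonnegative for
     every t. *)
  have hb : b ^+ 2 <= r n * `|S v| ^+ 2.
    apply: discr_le => t; have := JDZ (u n) v t; have := mJ (u n + t *: v).
    by have := hu n; rewrite -/b; lra.
  have en2 : r n <= (e / (2 * k)) ^+ 2 by apply/ltW/h2/leq_maxr.
  have ek : (e / (2 * k)) * k = e / 2 by field; lra.
  have Sk : `|S v| <= k by rewrite /k lerDr.
  have b2 : `|b| <= e / 2.
    apply: le_of_sqr_le; first by lra.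
    rewrite real_normK ?num_real//.
    apply: le_trans hb _; rewrite -ek exprMn.
    apply: ler_pM => //; first exact: ltW.
    by rewrite ler_pXn2r// nnegrE// ltW.
  have -> : inner w (S v) - f v = inner (w - S (u n)) (S v) + b.
    by rewrite innerBl /b; ring.
  apply: le_trans (ler_normD _ _) _.
  have := cauchy_schwarz (w - S (u n)) (S v).
  have : `|w - S (u n)| * `|S v| <= e / 2.
    by rewrite -ek ler_pM//; apply/ltW/h1/leq_maxl.
  by lra.
exists w; split=> //; rewrite leNgt; apply/negP => cw0.
(* With |w - S v| < e one gets |w|^2 <= e |w| + c (|w| + e), whereas |w| = c + 4 e makes |w|^2 - c
   |w| = 4 e |w| larger than e |w| + c e. *)
pose e := (`|w| - c) / 4; have e0 : 0 < e by rewrite /e; lra.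
have /closure_normP/(_ e e0)[_ [v _ <-] wv] := cw.
have ww : `|w| ^+ 2 = inner (w - S v) w + inner w (S v).
  by rewrite innerBl (innerC (S v)) inner_normE; ring.
have := inner_le (w - S v) w; have := ler_norm (f v); have := bf v; have := fw v.
have : `|S v| <= `|w| + e.
  by rewrite -(subKr w (S v)) (le_trans (ler_normB _ _))// lerD2l ltW.
have : `|w - S v| * `|w| <= e * `|w| by rewrite ler_wpM2r// ltW.
move: ww; rewrite /e; nra.
Qed.

End Riesz.

(** * Linear maps, bounded operators and adjoints *)

Section LinearMaps.
Context (R : realType) (V W : lmodType R) (T : V -> W) (linT : linear T).

Lemma linD x y : T (x + y) = T x + T y.
Proof. by have := linT 1 x y; rewrite !scale1r. Qed.

Lemma lin0 : T 0 = 0.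
Proof. by have := linT (-1) 0 0; rewrite !scaleN1r !addNr. Qed.

Lemma linZ a x : T (a *: x) = a *: T x.
Proof. by have := linT a x 0; rewrite lin0 !addr0. Qed.

Lemma linN x : T (- x) = - T x.
Proof. by rewrite -scaleN1r linZ scaleN1r. Qed.

Lemma linB x y : T (x - y) = T x - T y.
Proof. by rewrite linD linN. Qed.

End LinearMaps.

Section BoundedOperators.
Context (R : realType).
Implicit Types H K L : hilbertType R.

Lemma bounded_opP H K (T : H -> K) : bounded_op T <->
  linear T /\ exists2 c : R, 0 <= c & forall x, `|T x| <= c * `|x|.
Proof.
split=> [[lT cT]|[lT [c c0 hc]]]; split=> //.
  have /cvgrPdist_lt/(_ 1 ltr01) := cT 0.
  move=> /nbhs_ballP[d /= d0 hd]; exists (2 / d); first by rewrite divr_ge0// ltW.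
  move=> x; have [->|x0] := eqVneq x 0; first by rewrite (lin0 lT) !normr0 mulr0.
  have nx : 0 < `|x| by rewrite normr_gt0.
  pose a := d / (2 * `|x|).
  have a0 : 0 < a by rewrite divr_gt0// mulr_gt0.
  have : ball (0 : H) d (a *: x).
    rewrite -ball_normE /= sub0r normrN normrZ gtr0_norm//.
    by have -> : a * `|x| = d / 2; [rewrite /a; field; lra|lra].
  move=> /hd; rewrite (lin0 lT) sub0r normrN (linZ lT) normrZ gtr0_norm// => h.
  rewrite -(ler_pM2l a0); have -> : a * (2 / d * `|x|) = 1 by rewrite /a; field; lra.
  exact: ltW.
move=> x; apply/cvgrPdist_le => e e0; have c1 : 0 < c + 1 by lra.
apply/nbhs_ballP; exists (e / (c + 1)) => /=; first exact: divr_gt0.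
move=> y; rewrite -ball_normE /= -(linB lT) => h; apply: le_trans (hc _) _.
have hh : (c + 1) * (e / (c + 1)) = e by field; lra.
have := normr_ge0 (x - y); nra.
Qed.

Lemma bounded_lin H K (T : H -> K) : bounded_op T -> linear T.
Proof. by case. Qed.

Lemma bounded_comp H K L (S : K -> L) (T : H -> K) :
  bounded_op S -> bounded_op T -> bounded_op (S \o T).
Proof.
move=> [lS cS] [lT cT]; split; first by move=> a x y /=; rewrite lT lS.
by move=> x; apply: continuous_comp; [exact: cT|exact: cS].
Qed.

Lemma bounded_add H K (S T : H -> K) :
  bounded_op S -> bounded_op T -> bounded_op (S + T).
Proof.
move=> [lS cS] [lT cT]; split; last by move=> x; apply: cvgD; [exact: cS|exact: cT].
by move=> a x y; rewrite !fctE lS lT scalerDr addrACA.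
Qed.

Lemma bounded_opp H K (T : H -> K) : bounded_op T -> bounded_op (- T).
Proof.
move=> [lT cT]; split; last by move=> x; apply: cvgN; exact: cT.
by move=> a x y; rewrite !fctE lT opprD scalerN.
Qed.

Lemma bounded_zero H K : bounded_op (0 : H -> K).
Proof.
split; last by move=> x; exact: cvg_cst.
by move=> a x y; change ((0 : K) = a *: 0 + 0); rewrite scaler0 addr0.
Qed.

Lemma adj_unique H K (T : H -> K) (S : K -> H) :
  (forall x y, inner (T x) y = inner x (S y)) -> adj T = S.
Proof.
move=> h; apply/funext => y; apply: inner_ext => z; rewrite ![inner _ z]innerC -h.
by have := @xgetPex _ 0 [set S : K -> H | forall x y, inner (T x) y = inner x (S y)]
  (ex_intro _ S h) => /= ->.
Qed.

Lemma adjP H K (T : H -> K) : bounded_op T ->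
  forall x y, inner (T x) y = inner x (adj T y).
Proof.
move=> bT; have /bounded_opP[lT [c c0 hc]] := bT.
suff [S hS] : exists S : K -> H, forall x y, inner (T x) y = inner x (S y).
  by move=> x y; rewrite (adj_unique hS).
suff /choice[S hS] : forall y, exists s, forall x, inner (T x) y = inner x s.
  by exists S => x y; exact: hS.
move=> y.
have [| | | |w [_ hw _]] := @riesz_seminorm R H H id (fun x => inner (T x) y) (c * `|y|).
- by rewrite mulr_ge0.
- by [].
- by move=> a u v; rewrite lT innerDl innerZl.
- move=> x; apply: le_trans (cauchy_schwarz _ _) _.
  by rewrite mulrAC ler_wpM2r.
by exists w => x; rewrite [RHS]innerC; exact: hw.
Qed.

Lemma adjPr H K (T : H -> K) : bounded_op T ->
  forall x y, inner y (T x) = inner (adj T y) x.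
Proof. by move=> bT x y; rewrite innerC adjP// innerC. Qed.

Lemma bounded_adj H K (T : H -> K) : bounded_op T -> bounded_op (adj T).
Proof.
move=> bT; have /bounded_opP[lT [c c0 hc]] := bT; apply/bounded_opP; split.
  move=> a x y; apply: inner_ext => z.
  by rewrite innerDl innerZl -!adjPr// innerDl innerZl.
exists c => // y; have [->|n0] := eqVneq (adj T y) 0.
  by rewrite normr0 mulr_ge0.
rewrite -(@ler_pM2l _ `|adj T y|) ?normr_gt0//.
rewrite -expr2 -inner_normE -adjP//; apply: le_trans (inner_le _ _) _.
by rewrite mulrA ler_wpM2r// mulrC.
Qed.

Lemma adjK H K (T : H -> K) : bounded_op T -> adj (adj T) = T.
Proof. by move=> bT; apply: adj_unique => x y; rewrite -adjPr. Qed.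

Lemma adj_comp H K L (S : K -> L) (T : H -> K) :
  bounded_op S -> bounded_op T -> adj (S \o T) = adj T \o adj S.
Proof. by move=> bS bT; apply: adj_unique => x y /=; rewrite !adjP. Qed.

Lemma adj_opp H K (T : H -> K) : bounded_op T -> adj (- T) = - adj T.
Proof.
by move=> bT; apply: adj_unique => x y; rewrite !fctE innerNl innerNr !adjP.
Qed.

Lemma adj_zero H K : adj (0 : H -> K) = 0.
Proof. by apply: adj_unique => x y; rewrite inner0l inner0r. Qed.

Lemma adj_comp_eq0 H K (T : H -> K) : bounded_op T -> T \o adj T = 0 -> T = 0.
Proof.
move=> bT h; rewrite -(adjK bT); suff -> : adj T = 0 by rewrite adj_zero.
apply/funext => x; apply: inner_eq0; rewrite -adjP//.
by rewrite -[T _]/((T \o adj T) x) h inner0l.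
Qed.

Lemma closure_orthogonal H (D : set H) w :
  closure D w -> (forall d, D d -> inner w d = 0) -> w = 0.
Proof.
move=> /closure_normP cw h; apply: inner_eq0; apply: eq0_le_eps => e e0.
have w1 : 0 < `|w| + 1 by rewrite ltr_wpDl.
have [d Dd wd] := cw _ (divr_gt0 e0 w1).
have -> : inner w w = inner w (w - d) by rewrite innerBr (h d)// subr0.
have hh : (`|w| + 1) * (e / (`|w| + 1)) = e by field; lra.
have := cauchy_schwarz w (w - d); have := normr_ge0 w; nra.
Qed.

Lemma closure_rangeDZ (V : lmodType R) H (S : V -> H) a x y : linear S ->
  closure (range S) x -> closure (range S) y -> closure (range S) (a *: x + y).
Proof.
move=> lS /closure_normP cx /closure_normP cy; apply/closure_normP => e e0.
have a1 : 0 < 2 * (`|a| + 1) by have := normr_ge0 a; lra.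
have [_ [u _ <-] xu] := cx _ (divr_gt0 e0 a1).
have [_ [v _ <-] yv] := cy (e / 2) (divr_gt0 e0 (ltr0n _ 2)).
exists (S (a *: u + v)); first by exists (a *: u + v).
rewrite lS opprD addrACA -scalerBr; apply: le_lt_trans (ler_normD _ _) _.
have hh : (`|a| + 1) * (e / (2 * (`|a| + 1))) = e / 2.
  by field; have := normr_ge0 a; lra.
have := normr_ge0 a; have := normr_ge0 (x - S u); rewrite normrZ; nra.
Qed.

(** For each z the functional x |-> <T x, z> is dominated by c |z| |S x|, so it has a representer V
    z in the closure of range S. Representers there are unique, because range S separates the points
    of its closure; hence V is linear, and its adjoint is the required factor. *)
Lemma douglas H K L (S : H -> K) (T : H -> L) (c : R) :
  0 <= c -> bounded_op S -> bounded_op T -> (forall x, `|T x| <= c * `|S x|) ->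
  exists2 U : K -> L, bounded_op U & T = U \o S.
Proof.
move=> c0 bS bT TS; have lS := bounded_lin bS; have lT := bounded_lin bT.
have /choice[V hV] z : exists w, [/\ closure (range S) w,
    forall x, inner (T x) z = inner w (S x) & `|w| <= c * `|z|].
  apply: riesz_seminorm => //; first by rewrite mulr_ge0.
    by move=> a u v; rewrite lT innerDl innerZl.
  move=> x; apply: le_trans (cauchy_schwarz _ _) _.
  by rewrite mulrAC ler_wpM2r.
have bV : bounded_op V.
  apply/bounded_opP; split; last by exists c => // z; have [] := hV z.
  move=> a y z; have [cz hz _] := hV z; have [cy hy _] := hV y.
  have [cv hv _] := hV (a *: y + z).
  apply/eqP; rewrite -subr_eq0; apply/eqP; apply: (@closure_orthogonal _ (range S)).
    rewrite [_ - _]addrC -scaleN1r; apply: closure_rangeDZ => //.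
    exact: closure_rangeDZ.
  by move=> _ [x _ <-]; rewrite innerBl -hv innerDl innerZl -hy -hz innerDr innerZr; ring.
exists (adj V); first exact: bounded_adj.
apply/funext => x /=; apply: inner_ext => z; rewrite -adjPr//.
by have [_ -> _] := hV z; rewrite innerC.
Qed.

End BoundedOperators.

(** * Square roots of positive operators *)

Section SquareRoot.
Context (R : realType) (H : hilbertType R).
Implicit Types C S X Z : H -> H.

Lemma psd_bounded C : psd C -> bounded_op C.
Proof. by case. Qed.

Lemma psd_adj C : psd C -> adj C = C.
Proof. by case=> _ h _; exact: adj_unique. Qed.

Lemma psdC C : psd C -> forall x y, inner (C x) y = inner x (C y).
Proof. by case. Qed.

Lemma psd_ge0 C : psd C -> forall x, 0 <= inner (C x) x.
Proof. by case. Qed.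

Lemma psd_cauchy_schwarz C x y : psd C ->
  inner (C x) y ^+ 2 <= inner (C x) x * inner (C y) y.
Proof.
move=> [bC sC pC]; apply: discr_le => t.
suff -> : inner (C x) x + 2 * t * inner (C x) y + t ^+ 2 * inner (C y) y
  = inner (C (t *: y + x)) (t *: y + x) by exact: pC.
rewrite (bounded_lin bC) innerDl !innerDr !innerZl !innerZr.
by rewrite (innerC (C y) x) -(sC x y); ring.
Qed.

(** Cauchy-Schwarz for the form of C at x and C x bounds |C x|^4 by c^2 |x|^2 |C x|^2. *)
Lemma psd_norm_le C c : 0 <= c -> psd C ->
  (forall x, inner (C x) x <= c * inner x x) -> forall x, `|C x| <= c * `|x|.
Proof.
move=> c0 pC h x; have [->|n0] := eqVneq (C x) 0; first by rewrite normr0 mulr_ge0.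
have n1 : 0 < `|C x| by rewrite normr_gt0.
apply: le_of_sqr_le; first by rewrite mulr_ge0.
have := psd_cauchy_schwarz x (C x) pC; rewrite inner_normE.
have := h x; have := h (C x); rewrite !inner_normE.
have := psd_ge0 pC x; have := psd_ge0 pC (C x).
set a := inner _ _; set b := inner _ _; set u := `|C x| in n1 *; set v := `|x|.
move=> a0 b0 ha hb hab; have v0 : 0 <= v ^+ 2 by exact: sqr_ge0.
have u2 : 0 < u ^+ 2 by rewrite exprn_gt0.
have : b * a <= (c * v ^+ 2) * (c * u ^+ 2) by apply: ler_pM.
move=> hba; rewrite -(ler_pM2r u2) exprMn; apply: le_trans (le_trans hab hba) _.
by rewrite le_eqVlt; apply/orP; left; apply/eqP; ring.
Qed.

Section Contraction.
Variables (X : H -> H) (psdX : psd X) (X1 : forall x, `|X x| <= `|x|).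

(* The sequence increases to 1 - (1 - X)^(1/2); sqmaj is the scalar case X = 1. *)
Fixpoint sqiter n : H -> H :=
  if n is n'.+1 then fun x => 2^-1 *: (X x + sqiter n' (sqiter n' x)) else fun=> 0.

Fixpoint sqmaj n : R := if n is n'.+1 then (1 + sqmaj n' ^+ 2) / 2 else 0.

Lemma sqmaj_bound n : 0 <= sqmaj n /\ sqmaj n <= 1.
Proof. elim: n => [|n [IH0 IH1]] /=; [by split; lra|by split; nra]. Qed.

Lemma sqmaj_nd n : sqmaj n <= sqmaj n.+1.
Proof. by have /= := sqmaj_bound n; nra. Qed.

Lemma sqiter_lin n : linear (sqiter n).
Proof.
have lX := bounded_lin (psd_bounded psdX).
elim: n => [|n IH] a x y /=; first by rewrite scaler0 addr0.
by rewrite lX !IH addrACA -[a *: _ + _]scalerDr [LHS]scalerDr !scalerA mulrC.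
Qed.

Lemma sqiter_norm n x : `|sqiter n x| <= sqmaj n * `|x|.
Proof.
elim: n x => [|n IH] x /=; first by rewrite normr0 mul0r.
rewrite normrZ gtr0_norm ?invr_gt0//.
have [m0 _] := sqmaj_bound n.
have := ler_normD (X x) (sqiter n (sqiter n x)); have := X1 x.
have := IH (sqiter n x); have := ler_wpM2l m0 (IH x).
by move=> h1 h2 h3 h4; rewrite mulrAC [X in _ <= X]mulrC ler_wpM2l ?invr_ge0//; nra.
Qed.

(** The splitting Y'^2 - Y^2 = Y' (Y' - Y) + (Y' - Y) Y needs no commutation, and the majorant obeys
    the same recursion with equality. *)
Lemma sqiter_step n x : `|sqiter n.+1 x - sqiter n x| <= (sqmaj n.+1 - sqmaj n) * `|x|.
Proof.
elim: n x => [|n IH] x.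
  rewrite /= subr0 addr0 normrZ gtr0_norm ?invr_gt0//.
  by have := X1 x; nra.
set Y := sqiter n in IH *; set Y' := sqiter n.+1 in IH *.
set y := sqmaj n in IH *; set y' := sqmaj n.+1 in IH *.
have -> : sqiter n.+2 x - Y' x = 2^-1 *: (Y' (Y' x - Y x) + (Y' (Y x) - Y (Y x))).
  have lY' : linear Y' by exact: sqiter_lin.
  have -> : sqiter n.+2 x = 2^-1 *: (X x + Y' (Y' x)) by [].
  have -> : Y' x = 2^-1 *: (X x + Y (Y x)) by [].
  by rewrite (linB lY'); inner_ring.
have -> : sqmaj n.+2 - y' = 2^-1 * ((y' - y) * (y' + y)).
  have -> : sqmaj n.+2 = (1 + y' ^+ 2) / 2 by [].
  by rewrite [X in _ - X = _](_ : y' = (1 + y ^+ 2) / 2)//; field.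
rewrite normrZ gtr0_norm ?invr_gt0// -mulrA ler_wpM2l ?invr_ge0//.
apply: le_trans (ler_normD _ _) _.
have := sqiter_norm n.+1 (Y' x - Y x); have := IH (Y x); have := sqiter_norm n x.
rewrite -/Y -/Y' -/y -/y'; have := IH x.
have [y0 _] := sqmaj_bound n; have [y'0 _] := sqmaj_bound n.+1.
have yy := sqmaj_nd n; rewrite -/y -/y' in y0 y'0 yy.
have d0 : 0 <= y' - y by rewrite subr_ge0.
move=> h1 h2 h3 h4; have := ler_wpM2l y'0 h1; have := ler_wpM2l d0 h2; lra.
Qed.

Lemma sqiter_dist m n x : (m <= n)%N ->
  `|sqiter n x - sqiter m x| <= (sqmaj n - sqmaj m) * `|x|.
Proof.
move=> /subnK <-; elim: (n - m)%N => [|k IH]; first by rewrite !subrr normr0 mul0r.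
rewrite -(subrK (sqiter (k + m) x) (sqiter (k.+1 + m) x)) -addrA.
apply: le_trans (ler_normD _ _) _; have := sqiter_step (k + m) x.
rewrite addSn; lra.
Qed.

(** The rate d n is the distance from [sqmaj n] to its supremum, uniform in x. The bound by 1 -
    sqmaj n makes L a contraction when read at n = 0, and this is what makes 1 - L positive. *)
Lemma sqiter_limit : exists (L : H -> H) (d : nat -> R),
  [/\ forall n x, `|L x - sqiter n x| <= d n * `|x|,
      forall n, d n.+1 <= d n,
      forall n, 0 <= d n <= 1 - sqmaj n
    & forall e, 0 < e -> exists n, d n < e].
Proof.
have hs : has_sup (range sqmaj).
  by split; [exists (sqmaj 0); exists 0%N|exists 1 => _ [n _ <-]; exact: (sqmaj_bound n).2].
pose s := sup (range sqmaj).
have ms n : sqmaj n <= s by apply: ub_le_sup; [exact: hs.2|exists n].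
have s1 : s <= 1.
  by apply: ge_sup; [exact: hs.1|move=> _ [n _ <-]; exact: (sqmaj_bound n).2].
have small e : 0 < e -> exists n, s - sqmaj n < e.
  move=> e0; have [_ [n _ <-] h] : exists2 y, range sqmaj y & s - e < y.
    exact: sup_adherent.
  by exists n; lra.
have dist m n x : (m <= n)%N -> `|sqiter n x - sqiter m x| <= (s - sqmaj m) * `|x|.
  move=> /sqiter_dist h; apply: le_trans (h x) _; rewrite ler_wpM2r//.
  by have := ms n; lra.
have /choice[L hL] x : exists l, forall e, 0 < e -> exists N, forall n, (N <= n)%N ->
    `|l - sqiter n x| < e.
  apply: cauchy_seq_cvg => e e0; have x1 : 0 < 2 * (`|x| + 1).
    by have := normr_ge0 x; lra.
  have [N hN] := small _ (divr_gt0 e0 x1); exists N => m n Nm Nn.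
  have -> : sqiter m x - sqiter n x =
      (sqiter m x - sqiter N x) - (sqiter n x - sqiter N x).
    by inner_ring.
  apply: le_lt_trans (ler_normB _ _) _.
  have := dist _ _ x Nm; have := dist _ _ x Nn.
  have hh : (`|x| + 1) * (e / (2 * (`|x| + 1))) = e / 2.
    by field; have := normr_ge0 x; lra.
  by have := ms N; have := normr_ge0 x; nra.
exists L, (fun n => s - sqmaj n); split => //.
- move=> n x; apply/ler_addgt0Pr => e e0; have [N hN] := hL x e e0.
  pose k := maxn N n; have := dist n k x (leq_maxr _ _).
  have := hN k (leq_maxl _ _).
  have := ler_normD (L x - sqiter k x) (sqiter k x - sqiter n x).
  by rewrite addrA subrK; lra.
- by move=> n; rewrite lerD2l lerN2 sqmaj_nd.
- by move=> n; rewrite subr_ge0 ms lerD2r.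
Qed.

(** In the limit the recursion reads 2 L = X + L^2, that is (1 - L)^2 = 1 - X, so S = 1 - L. An
    operator commuting with X commutes with every iterate, hence with L. *)
Lemma contraction_sqrt : exists S, [/\ psd S, forall x, S (S x) = x - X x
  & forall Z, bounded_op Z -> (forall x, Z (X x) = X (Z x)) ->
      forall x, Z (S x) = S (Z x)].
Proof.
have [L [d [hL dn d01 d_small]]] := sqiter_limit.
have eq0 (z : H) K : 0 <= K -> (forall n, `|z| <= d n * K) -> z = 0.
  move=> K0 h; apply/eqP; rewrite -normr_le0; apply/ler_addgt0Pr => e e0.
  rewrite add0r; have K1 : 0 < K + 1 by lra.
  have [n hn] := d_small _ (divr_gt0 e0 K1).
  have hh : (K + 1) * (e / (K + 1)) = e by field; lra.
  by have := h n; have /andP[] := d01 n; nra.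
have L1 x : `|L x| <= `|x|.
  rewrite -(subrK (sqiter 0 x) (L x)) /= addr0; apply: le_trans (hL 0%N x) _.
  by have /andP[] := d01 0%N; rewrite /=; have := normr_ge0 x; nra.
have L_lin : linear L.
  move=> a x y; apply/eqP; rewrite -subr_eq0; apply/eqP.
  apply: (eq0 _ (`|a *: x + y| + (`|a| * `|x| + `|y|))).
    by rewrite !addr_ge0// mulr_ge0.
  move=> n; have -> : L (a *: x + y) - (a *: L x + L y) =
     (L (a *: x + y) - sqiter n (a *: x + y)) -
     (a *: (L x - sqiter n x) + (L y - sqiter n y)).
    by rewrite sqiter_lin; inner_ring.
  apply: le_trans (ler_normB _ _) _; rewrite mulrDr lerD//.
  apply: le_trans (ler_normD _ _) _; rewrite mulrDr lerD// normrZ mulrCA.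
  by rewrite ler_wpM2l.
have LE x : L x = 2^-1 *: (X x + L (L x)).
  apply/eqP; rewrite -subr_eq0; apply/eqP.
  apply: (eq0 _ (3 * `|x|)); first by rewrite mulr_ge0.
  move=> n; have -> : L x - 2^-1 *: (X x + L (L x)) =
      (L x - sqiter n.+1 x) - 2^-1 *: ((L (L x) - sqiter n (L x)) +
          sqiter n (L x - sqiter n x)).
    by rewrite (linB (@sqiter_lin n)) /=; inner_ring.
  apply: le_trans (ler_normB _ _) _; rewrite normrZ gtr0_norm ?invr_gt0//.
  have := ler_normD (L (L x) - sqiter n (L x)) (sqiter n (L x - sqiter n x)).
  have := sqiter_norm n (L x - sqiter n x); have := hL n (L x); have := hL n x.
  have := hL n.+1 x; have := dn n; have [m0 m1] := sqmaj_bound n.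
  have := L1 x; have /andP[d0 _] := d01 n; have := normr_ge0 (L x - sqiter n x).
  have := normr_ge0 x.
  set A := `|L x - sqiter n.+1 x|; set B := `|L x - sqiter n x|.
  set E := `|sqiter n _|; set F := `|_ + _|; set G := `|_ - _|.
  move=> x0 B0 Lx dd hA hB hG hE hF.
  have : d n.+1 * `|x| <= d n * `|x| by rewrite ler_wpM2r.
  have : d n * `|L x| <= d n * `|x| by rewrite ler_wpM2l.
  have : sqmaj n * B <= B by rewrite ler_piMl.
  lra.
have LC x y : inner (L x) y = inner x (L y).
  have sC n u v : inner (sqiter n u) v = inner u (sqiter n v).
    elim: n u v => [|n IH] u v /=; first by rewrite inner0l inner0r.
    by rewrite innerZl innerZr innerDl innerDr (psdC psdX) !IH.
  apply/eqP; rewrite -subr_eq0; apply/eqP/eq0_le_eps => e e0.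
  have k1 : 0 < 2 * (`|x| * `|y|) + 1.
    by have := mulr_ge0 (normr_ge0 x) (normr_ge0 y); lra.
  have [n hn] := d_small _ (divr_gt0 e0 k1).
  have -> : inner (L x) y - inner x (L y) =
     inner (L x - sqiter n x) y - inner x (L y - sqiter n y).
    by rewrite innerBl innerBr sC; ring.
  apply: le_trans (ler_normB _ _) _.
  have := cauchy_schwarz (L x - sqiter n x) y.
  have := cauchy_schwarz x (L y - sqiter n y).
  have := ler_wpM2r (normr_ge0 y) (hL n x); have := ler_wpM2l (normr_ge0 x) (hL n y).
  have hh : (2 * (`|x| * `|y|) + 1) * (e / (2 * (`|x| * `|y|) + 1)) = e.
    by field; lra.
  have /andP[d0 _] := d01 n; have := mulr_ge0 (normr_ge0 x) (normr_ge0 y); nra.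
exists (fun x => x - L x); split.
- split.
  + apply/bounded_opP; split.
      by move=> a x y; rewrite L_lin; inner_ring.
    exists 2 => // x; apply: le_trans (ler_normB _ _) _; have := L1 x; lra.
  + by move=> x y; rewrite innerBl innerBr LC.
  + move=> x; rewrite innerBl subr_ge0; apply: le_trans (inner_le _ _) _.
    by rewrite inner_normE expr2 ler_wpM2r.
- move=> x; rewrite (linB L_lin).
  have : L (L x) = 2 *: L x - X x by rewrite [X in 2 *: X]LE; inner_ring.
  by move=> ->; inner_ring.
- move=> Z /bounded_opP[lZ [c c0 hc]] ZX x.
  have Zn n u : Z (sqiter n u) = sqiter n (Z u).
    elim: n u => [|n IH] u /=; first exact: lin0.
    by rewrite (linZ lZ) (linD lZ) ZX !IH.
  rewrite (linB lZ); congr (_ - _); apply/eqP; rewrite -subr_eq0; apply/eqP.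
  apply: (eq0 _ (c * `|x| + `|Z x|)); first by rewrite addr_ge0// mulr_ge0.
  move=> n; have -> : Z (L x) - L (Z x) =
      Z (L x - sqiter n x) - (L (Z x) - sqiter n (Z x)).
    by rewrite (linB lZ) Zn; inner_ring.
  apply: le_trans (ler_normB _ _) _; rewrite mulrDr lerD//.
  apply: le_trans (hc _) _; rewrite mulrCA; exact: ler_wpM2l.
Qed.

End Contraction.
End SquareRoot.

Section SquareRootOperator.
Context (R : realType) (H : hilbertType R).
Implicit Types C S T : H -> H.

Lemma psd_sqrt_commuting C : psd C -> exists S, [/\ psd S, S \o S = C
  & forall Z, bounded_op Z -> Z \o C = C \o Z -> Z \o S = S \o Z].
Proof.
move=> pC; have /bounded_opP[lC [c c0 hc]] := psd_bounded pC.
(* Rescaling to X = 1 - C / k, a positive contraction; c + 1 instead of c allows the division when c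
   = 0. The root of C is k^(1/2) times the root of 1 - X. *)
pose k := c + 1; have k0 : 0 < k by rewrite /k; lra.
pose X x := x - k^-1 *: C x.
have kC x : k^-1 * inner (C x) x <= inner x x.
  rewrite ler_pdivrMl//; apply: le_trans (inner_le _ _) _; rewrite inner_normE.
  by have := hc x; have := normr_ge0 x; rewrite /k; nra.
have pX : psd X.
  split.
  - apply/bounded_opP; split; first by move=> a x y; rewrite /X lC; inner_ring; lra.
    exists (1 + k^-1 * c); first by rewrite addr_ge0// mulr_ge0// invr_ge0 ltW.
    move=> x; apply: le_trans (ler_normB _ _) _; rewrite mulrDl mul1r lerD2l.
    by rewrite normrZ gtr0_norm ?invr_gt0// -mulrA ler_wpM2l// invr_ge0 ltW.
  - by move=> x y; rewrite /X innerBl innerBr innerZl innerZr (psdC pC).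
  - by move=> x; rewrite /X innerBl innerZl subr_ge0.
have X1 x : `|X x| <= `|x|.
  rewrite -[leRHS]mul1r; apply: psd_norm_le => // {}x.
  rewrite mul1r /X innerBl innerZl gerBl; apply: mulr_ge0; last exact: psd_ge0.
  by rewrite invr_ge0 ltW.
have [S [pS SS SZ]] := contraction_sqrt pX X1.
have lS := bounded_lin (psd_bounded pS).
have kk : Num.sqrt k * Num.sqrt k = k by rewrite -expr2 sqr_sqrtr// ltW.
exists (fun x => Num.sqrt k *: S x); split.
- split.
  + have /bounded_opP[_ [d d0 hd]] := psd_bounded pS.
    apply/bounded_opP; split; first by move=> a x y; rewrite lS; inner_ring.
    exists (Num.sqrt k * d); first by rewrite mulr_ge0// sqrtr_ge0.
    by move=> x; rewrite normrZ ger0_norm ?sqrtr_ge0// -mulrA ler_wpM2l ?sqrtr_ge0.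
  + by move=> x y; rewrite innerZl innerZr (psdC pS).
  + by move=> x; rewrite innerZl mulr_ge0 ?sqrtr_ge0//; exact: psd_ge0.
- apply/funext => x /=; rewrite (linZ lS) scalerA kk SS /X opprB addrC subrK.
  by rewrite scalerA divff ?scale1r// lt0r_neq0.
- move=> Z bZ ZC; have lZ := bounded_lin bZ.
  have ZX x : Z (X x) = X (Z x).
    by rewrite /X (linB lZ) (linZ lZ) -[Z (C x)]/((Z \o C) x) ZC.
  by apply/funext => x /=; rewrite (linZ lZ) SZ.
Qed.

Lemma psd_form_eq0 S x : psd S -> inner (S x) x = 0 -> S x = 0.
Proof.
move=> pS Sx; apply: inner_eq0; apply/eqP; rewrite -sqrf_eq0 -real_normK ?num_real//.
rewrite sqrf_eq0 normr_eq0 -sqrf_eq0 eq_le sqr_ge0 andbT.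
by apply: le_trans (psd_cauchy_schwarz x (S x) pS) _; rewrite Sx mul0r.
Qed.

(** Each root P is compared with the root Q of [psd_sqrt_commuting]: P commutes with its own square,
    so Q commutes with P. For y = P x - Q x this gives (P + Q) y = (P^2 - Q^2) x = 0. Both
    nonnegative forms then vanish at y, so P y = Q y = 0 and |y|^2 = <x, P y - Q y> = 0. *)
Lemma psd_sqrt_unique S T : psd S -> psd T -> S \o S = T \o T -> S = T.
Proof.
move=> pS pT ST.
have pC : psd (S \o S).
  split; first by apply: bounded_comp; exact: psd_bounded.
    by move=> x y /=; rewrite !(psdC pS).
  by move=> x /=; rewrite (psdC pS) inner_ge0.
have [Q [pQ QQ Qcomm]] := psd_sqrt_commuting pC.
suff uniq P : psd P -> P \o P = S \o S -> P = Q by rewrite (uniq S)// (uniq T).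
move=> pP PP; have bP := psd_bounded pP; have lP := bounded_lin bP.
have lQ := bounded_lin (psd_bounded pQ).
have PQ x : P (Q x) = Q (P x).
  by rewrite -[LHS]/((P \o Q) x) Qcomm// -PP.
have PPx x : P (P x) = Q (Q x).
  by rewrite -[LHS]/((P \o P) x) PP -QQ.
apply/funext => x; apply/eqP; rewrite -subr_eq0; apply/eqP.
set y := P x - Q x.
have y0 : inner (P y) y + inner (Q y) y = 0.
  rewrite -innerDl -[RHS](inner0l y); congr inner.
  by rewrite /y (linB lP) (linB lQ) PPx PQ; inner_ring.
have Py : inner (P y) y = 0.
  by apply/eqP; rewrite eq_le psd_ge0// andbT; have := psd_ge0 pQ y; lra.
have Qy : inner (Q y) y = 0 by move: y0; rewrite Py add0r.
apply: inner_eq0; rewrite {1}/y innerBl (psdC pP) (psdC pQ).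
by rewrite (psd_form_eq0 pP Py) (psd_form_eq0 pQ Qy) !inner0r subrr.
Qed.

Lemma sqrtop_unique S C : psd S -> S \o S = C -> sqrtop C = S.
Proof.
move=> pS SC; apply: xget_subset1 => // T1 T2 [p1 e1] [p2 e2].
by apply: psd_sqrt_unique => //; rewrite e1 e2.
Qed.

Lemma sqrtopP C : psd C -> psd (sqrtop C) /\ sqrtop C \o sqrtop C = C.
Proof.
by move=> pC; have [S [pS SS _]] := psd_sqrt_commuting pC; rewrite (sqrtop_unique pS SS).
Qed.

Lemma psd_sqrtop C : psd C -> psd (sqrtop C).
Proof. by case/sqrtopP. Qed.

Lemma sqrtopK C x : psd C -> sqrtop C (sqrtop C x) = C x.
Proof. by case/sqrtopP => _ h; rewrite -[LHS]/((sqrtop C \o sqrtop C) x) h. Qed.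

Lemma sqr_norm_sqrtop C x : psd C -> `|sqrtop C x| ^+ 2 = inner (C x) x.
Proof.
by move=> pC; rewrite -inner_normE (psdC (psd_sqrtop pC)) sqrtopK// innerC.
Qed.

Lemma norm_sqrtop (K : hilbertType R) C (D : H -> K) x :
  psd C -> inner (C x) x = `|D x| ^+ 2 ->
  `|sqrtop C x| = `|D x|.
Proof.
move=> pC; rewrite -sqr_norm_sqrtop// => /eqP.
by rewrite eqrXn2// => /eqP.
Qed.

Lemma sqrtop_eq0 C x : psd C -> sqrtop C x = 0 <-> C x = 0.
Proof.
move=> pC; split=> [h|h]; last first.
  by apply: inner_eq0; rewrite inner_normE sqr_norm_sqrtop// h inner0l.
by rewrite -sqrtopK// h (lin0 (bounded_lin (psd_bounded (psd_sqrtop pC)))).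
Qed.

End SquareRootOperator.

Section AdjointSquares.
Context (R : realType).
Implicit Types H K : hilbertType R.

Lemma psd_adj_comp H K (T : H -> K) : bounded_op T -> psd (adj T \o T).
Proof.
move=> bT; split.
- by apply: bounded_comp => //; exact: bounded_adj.
- by move=> x y /=; rewrite -adjPr// -adjP.
- by move=> x /=; rewrite -adjPr// inner_ge0.
Qed.

Lemma psd_sandwich H K (C : K -> K) (T : H -> K) : psd C -> bounded_op T ->
  psd (adj T \o C \o T).
Proof.
move=> pC bT; have bC := psd_bounded pC; split.
- apply: bounded_comp => //; apply: bounded_comp => //; exact: bounded_adj.
- by move=> x y /=; rewrite -adjPr// -adjP// (psdC pC).
- by move=> x /=; rewrite -adjPr// (psdC pC) -(psdC pC); exact: psd_ge0.
Qed.

End AdjointSquares.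

(** * Pseudoinverses and projections *)

Section Pseudoinverse.
Context (R : realType).
Implicit Types H K : hilbertType R.

Lemma pseudoinv_unique H K (T : H -> K) y x : linear T ->
  (forall z, T z = 0 -> inner x z = 0) -> (forall z, inner (y - T x) (T z) = 0) ->
  pseudoinv T y = x.
Proof.
move=> lT xN yT; apply: xget_subset1 => //= x1 x2 [N1 P1] [N2 P2].
apply/eqP; rewrite -subr_eq0; apply/eqP/inner_eq0.
have T0 : T (x1 - x2) = 0.
  apply: inner_eq0; rewrite {1}(linB lT).
  have -> : T x1 - T x2 = (y - T x2) - (y - T x1) by inner_ring.
  by rewrite innerBl P1 P2 subrr.
by rewrite {1}innerBl (N1 _ T0) (N2 _ T0) subrr.
Qed.

Lemma closure_range_null H (S : H -> H) w z : psd S -> closure (range S) w ->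
  S z = 0 -> inner w z = 0.
Proof.
move=> pS cw Sz; apply: eq0_le_eps => e e0.
have k0 : 0 < `|z| + 1 by rewrite ltr_wpDl.
have /closure_normP/(_ _ (divr_gt0 e0 k0))[_ [v _ <-] wv] := cw.
have -> : inner w z = inner (w - S v) z by rewrite innerBl (psdC pS) Sz inner0r subr0.
have hh : (`|z| + 1) * (e / (`|z| + 1)) = e by clear Sz; field; lra.
clear Sz; have := cauchy_schwarz (w - S v) z; have := normr_ge0 z; nra.
Qed.

(** The domination hypothesis is the quantitative form of y being in range S. The representer w of x
    |-> <y, x> solves S w = y because S is symmetric, and it is orthogonal to the null space because
    it lies in the closure of the range. *)
Lemma pseudoinvP H (S : H -> H) y c : psd S -> 0 <= c ->
  (forall x, `|inner y x| <= c * `|S x|) ->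
  [/\ S (pseudoinv S y) = y, closure (range S) (pseudoinv S y)
    & `|pseudoinv S y| <= c].
Proof.
move=> pS c0 h; have lS := bounded_lin (psd_bounded pS).
have [|w [cw hw wc]] := riesz_seminorm c0 lS _ h.
  by move=> a u v; rewrite innerDr innerZr.
have Sw : S w = y by apply: inner_ext => z; rewrite (psdC pS) -hw.
suff -> : pseudoinv S y = w by [].
apply: pseudoinv_unique => // z; first exact: closure_range_null.
by rewrite Sw subrr inner0l.
Qed.

Lemma pseudoinv_comp H K (S : H -> H) (F : K -> H) c : psd S -> 0 <= c ->
  linear F -> (forall u x, `|inner (F u) x| <= c * `|u| * `|S x|) ->
  [/\ bounded_op (pseudoinv S \o F), S \o (pseudoinv S \o F) = F
    & forall u, closure (range S) (pseudoinv S (F u))].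
Proof.
move=> pS c0 lF h; have lS := bounded_lin (psd_bounded pS).
have P u := pseudoinvP pS (mulr_ge0 c0 (normr_ge0 u)) (h u).
split; last by move=> u; have [] := P u.
- apply/bounded_opP; split; last by exists c => // u; have [] := P u.
  move=> a u v /=; have [Su Cu _] := P u; have [Sv Cv _] := P v.
  apply: pseudoinv_unique => // z.
    by apply: closure_range_null => //; exact: closure_rangeDZ.
  by rewrite lS Su Sv lF subrr inner0l.
- by apply/funext => u /=; have [] := P u.
Qed.

End Pseudoinverse.

Section Projections.
Context (R : realType) (H : hilbertType R).
Implicit Types U V W : closedSubspace H.

(** The projection exists as the representer of <x, .> for the inclusion of W; it stays in W because
    W is closed. *)
Lemma oprojP W x (w : W) : inner (oproj W x) w = inner x (val w).
Proof.
suff [p hp] : exists p : W, forall w : W, inner (x - val p) (val w) = 0.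
  have /= h := @xgetPex _ 0 [set p : W | forall w : W, inner (x - val p) (val w) = 0]
    (ex_intro _ p hp).
  by apply/esym/eqP; rewrite -subr_eq0 subspace_innerE -innerBl h.
have [| | | |v [cv hv _]] :=
    @riesz_seminorm R W H val (fun w => inner x (val w)) `|x|.
- by [].
- by move=> a u v.
- by move=> a u v; rewrite innerDr innerZr.
- by move=> u; exact: cauchy_schwarz.
have Wv : carrier W v.
  apply: (@carrier_closed _ _ W); apply: closureS cv => _ [u _ <-].
  exact/set_mem/(valP u).
exists (exist _ v (mem_set Wv)) => u; rewrite innerBl hv; exact: subrr.
Qed.

Lemma bounded_val W : bounded_op (val : W -> H).
Proof. by apply/bounded_opP; split=> //; exists 1 => // x; rewrite mul1r. Qed.

Lemma adj_val W : adj (val : W -> H) = oproj W.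
Proof. by apply: adj_unique => x y; rewrite innerC -oprojP innerC. Qed.

Lemma bounded_oproj W : bounded_op (oproj W).
Proof. by rewrite -adj_val; apply: bounded_adj; exact: bounded_val. Qed.

Lemma adj_oproj W : adj (oproj W) = val.
Proof. by rewrite -adj_val adjK//; exact: bounded_val. Qed.

Lemma oproj_val W (w : W) : oproj W (val w) = w.
Proof. by apply: inner_ext => z; rewrite oprojP. Qed.

Lemma bounded_block U V T : bounded_op T -> bounded_op (block U V T).
Proof.
move=> bT; exact: bounded_comp (bounded_oproj U) (bounded_comp bT (bounded_val V)).
Qed.

Lemma inner_block U V T x y : inner (block U V T x) y = inner (T (val x)) (val y).
Proof. exact: oprojP. Qed.

Lemma adj_block U V T : bounded_op T -> adj (block U V T) = block V U (adj T).
Proof.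
move=> bT; apply: adj_unique => x y.
by rewrite inner_block [RHS]innerC inner_block [RHS]innerC adjP.
Qed.

Lemma psd_block U T : psd T -> psd (block U U T).
Proof.
move=> [bT sT pT]; split; first exact: bounded_block.
  by move=> x y; rewrite inner_block sT [RHS]innerC inner_block [RHS]innerC.
by move=> x; rewrite inner_block.
Qed.

End Projections.

(** * Block equations *)

Section SquareForms.
Context (R : realType).
Implicit Types H K : hilbertType R.

Lemma sym_form_eq0 H (T : H -> H) : linear T ->
  (forall x y, inner (T x) y = inner x (T y)) -> (forall x, inner (T x) x = 0) ->
  T = 0.
Proof.
move=> lT sT T0; apply/funext => x; apply: inner_ext => y; rewrite inner0l.
have := T0 (x + y); rewrite (linD lT) innerDl !innerDr !T0 (sT y) (innerC y).
lra.
Qed.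

Lemma adj_comp_norm_eq H K K' (S : H -> K) (T : H -> K') :
  bounded_op S -> bounded_op T -> (forall x, `|S x| = `|T x|) ->
  adj S \o S = adj T \o T.
Proof.
move=> bS bT ST; have pS := psd_adj_comp bS; have pT := psd_adj_comp bT.
apply/funext => x; apply/eqP; rewrite -subr_eq0; apply/eqP.
rewrite -[LHS]/(((adj S \o S) - (adj T \o T)) x) (@sym_form_eq0 _ (_ - _))//.
- by apply: bounded_lin; apply: bounded_add; [|apply: bounded_opp]; exact: psd_bounded.
- by move=> u v; rewrite !fctE innerBl innerBr -!adjPr// -!adjP.
- by move=> u; rewrite !fctE innerBl -!adjPr// !inner_normE ST subrr.
Qed.

(** A representer in the closure of range S has the least possible norm: it equals the norm of the
    functional for the seminorm |S v|, and |T v| is the same seminorm. *)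
Lemma representer_norm_le (V : lmodType R) H K (S : V -> H) (T : V -> K) w w' :
  (forall v, `|S v| = `|T v|) -> closure (range S) w ->
  (forall v, inner w (S v) = inner w' (T v)) -> `|w| <= `|w'|.
Proof.
move=> ST /closure_normP cw ww'; rewrite leNgt; apply/negP => lt_w.
pose e := (`|w| - `|w'|) / 4; have e0 : 0 < e by rewrite /e; lra.
have [_ [v _ <-] wv] := cw _ e0.
have : `|w| ^+ 2 = inner w (w - S v) + inner w' (T v).
  by rewrite innerBr ww' -inner_normE subrK.
have := inner_le w (w - S v); have := inner_le w' (T v); rewrite -ST.
have : `|S v| <= `|w| + e.
  by have := ler_normB w (w - S v); rewrite subKr; lra.
have := normr_ge0 w'; have := normr_ge0 w.
clear ST ww'; rewrite /e in wv *; nra.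
Qed.

(** The representer w of v |-> <x, P v> is the projection of x onto the closed range, and by
    symmetry P annihilates x - w. *)
Lemma injective_dense_range H (P : H -> H) x : psd P ->
  (forall u, P u = 0 -> u = 0) -> closure (range P) x.
Proof.
move=> pP inj; have lP := bounded_lin (psd_bounded pP).
have [|||w [cw hw _]] := @riesz_seminorm R H H P (fun v => inner x (P v)) `|x| _ lP.
- by [].
- by move=> a u v; rewrite lP innerDr innerZr.
- by move=> v; exact: cauchy_schwarz.
suff -> : x = w by [].
apply/eqP; rewrite -subr_eq0; apply/eqP/inj; apply: inner_ext => z.
by rewrite (psdC pP) innerBl hw subrr inner0l.
Qed.

Lemma closure_range_comp H K (S : H -> K) (P : H -> H) w : bounded_op S ->
  (forall x, closure (range P) x) -> closure (range S) w ->
  closure (range (S \o P)) w.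
Proof.
move=> /bounded_opP[lS [c c0 hc]] dP /closure_normP cw.
apply/closure_normP => e e0; have [_ [v _ <-] wv] := cw _ (divr_gt0 e0 (ltr0n _ 2)).
have k0 : 0 < 2 * (c + 1) by lra.
have /closure_normP/(_ _ (divr_gt0 e0 k0))[_ [u _ <-] vu] := dP v.
exists (S (P u)); first by exists u.
have -> : w - S (P u) = (w - S v) + S (v - P u).
  by rewrite (linB lS) addrA subrK.
apply: le_lt_trans (ler_normD _ _) _; have := hc (v - P u).
have hh : (c + 1) * (e / (2 * (c + 1))) = e / 2 by field; lra.
by have := normr_ge0 (v - P u); nra.
Qed.

End SquareForms.

(** * Weighting by an injective positive operator *)

Section WeightedBlock.
Context (R : realType) (K1 K2 : hilbertType R).
Variables (P B11 : K1 -> K1) (B12 : K2 -> K1) (c : R).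
Hypotheses (psdP : psd P) (injP : forall u, P u = 0 -> u = 0) (psdB : psd B11).
Hypotheses (bndB12 : bounded_op B12) (c_ge0 : 0 <= c).
Hypothesis (B12_le : forall y x, `|inner (B12 y) x| <= c * `|y| * `|sqrtop B11 x|).

(** Here P stands for A11^(1/2). Q will be the entry M11, C is the root subtracted in the Schur
    complement, and D is the particular solution for the adjoint of M21. *)
Let G := P \o B11 \o P.
Let Q := pseudoinv P \o sqrtop G.
Let C := pseudoinv (sqrtop B11) \o B12.
Let D := pseudoinv (sqrtop G) \o P \o B12.

Lemma psd_weighted : psd G.
Proof. by have := psd_sandwich psdB (psd_bounded psdP); rewrite psd_adj. Qed.

Let psdGs : psd (sqrtop G) := psd_sqrtop psd_weighted.

(** Both squares are <B11 P x, P x>. Through this equality bounds relative to B11^(1/2) become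
    bounds relative to G^(1/2). *)
Lemma norm_sqrt_weighted x : `|sqrtop G x| = `|sqrtop B11 (P x)|.
Proof.
apply: (@norm_sqrtop _ _ _ _ (sqrtop B11 \o P)) => /=; first exact: psd_weighted.
by rewrite sqr_norm_sqrtop// /G /= (psdC psdP).
Qed.

Lemma null_sqrt_weighted : nullspace (sqrtop B11 \o P) = nullspace (sqrtop G).
Proof.
apply/seteqP; split=> x /= h; apply/normr0_eq0.
  by rewrite norm_sqrt_weighted -[sqrtop B11 _]/((sqrtop B11 \o P) x) h normr0.
by rewrite /= -norm_sqrt_weighted h normr0.
Qed.

(** Q is bounded although [pseudoinv P] need not be: |<G^(1/2) u, x>| <= |u| |B11^(1/2) P x| <= d
    |u| |P x|, where d bounds B11^(1/2). *)
Lemma weighted_map : bounded_op Q /\ P \o Q = sqrtop G.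
Proof.
have /bounded_opP[_ [d d0 hd]] := psd_bounded (psd_sqrtop psdB).
have [|bQ PQ _] := pseudoinv_comp psdP d0 (bounded_lin (psd_bounded psdGs)).
  move=> u x; rewrite (psdC psdGs).
  apply: le_trans (cauchy_schwarz _ _) _; rewrite norm_sqrt_weighted.
  by rewrite [d * _]mulrC -mulrA ler_wpM2l.
by split.
Qed.

(** From P Q = G^(1/2) one gets P Q Q^* P = G = P B11 P. The left P cancels by injectivity; the
    right one is moved to the left by symmetry and cancelled again. *)
Lemma weighted_map_sqr : Q \o adj Q = B11.
Proof.
have [bQ PQ] := weighted_map; have bB := psd_bounded psdB.
have pQ : psd (Q \o adj Q) by have := psd_adj_comp (bounded_adj bQ); rewrite adjK.
have lQ := bounded_lin (psd_bounded pQ); have lP := bounded_lin (psd_bounded psdP).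
have QP x : adj Q (P x) = sqrtop G x.
  rewrite -[LHS]/((adj Q \o P) x) -{1}(psd_adj psdP) -adj_comp//.
    by rewrite PQ psd_adj.
  exact: psd_bounded.
have QBP x : (Q \o adj Q) (P x) = B11 (P x).
  apply/eqP; rewrite -subr_eq0; apply/eqP/injP; rewrite (linB lP) /= QP.
  by rewrite -[P (Q _)]/((P \o Q) _) PQ sqrtopK ?subrr//; exact: psd_weighted.
apply/funext => z; apply/eqP; rewrite -subr_eq0; apply/eqP/injP.
apply: inner_ext => x; rewrite inner0l (psdC psdP) innerBl (psdC pQ) (psdC psdB).
by rewrite QBP subrr.
Qed.

Lemma schur_root : bounded_op C /\ forall y, closure (range (sqrtop B11)) (C y).
Proof.
by have [] := pseudoinv_comp (psd_sqrtop psdB) c_ge0 (bounded_lin bndB12) B12_le.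
Qed.

Lemma schur_rootK y : sqrtop B11 (C y) = B12 y.
Proof.
have [_ h _] := pseudoinv_comp (psd_sqrtop psdB) c_ge0 (bounded_lin bndB12) B12_le.
by rewrite -[LHS]/((sqrtop B11 \o (pseudoinv (sqrtop B11) \o B12)) y) h.
Qed.

(** The bound [B12_le] at P x is the domination needed for G^(1/2), because |B11^(1/2) P x| =
    |G^(1/2) x|. *)
Lemma weighted_root : [/\ bounded_op D, sqrtop G \o D = P \o B12
  & forall y, closure (range (sqrtop G)) (D y)].
Proof.
have bPB : bounded_op (P \o B12) by apply: bounded_comp => //; exact: psd_bounded.
have [|bD GD cD] := pseudoinv_comp psdGs c_ge0 (bounded_lin bPB).
  by move=> y x /=; rewrite (psdC psdP) norm_sqrt_weighted.
by split.
Qed.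

Lemma weighted_root_sqr : adj D \o D = adj C \o C.
Proof.
have [bD GD cD] := weighted_root; have [bC cC] := schur_root.
apply: adj_comp_norm_eq => // y.
(* Both sides equal <P B12 y, v>. *)
have DC v : inner (D y) (sqrtop G v) = inner (C y) ((sqrtop B11 \o P) v).
  rewrite -(psdC psdGs) -(psdC (psd_sqrtop psdB)) schur_rootK -(psdC psdP).
  by rewrite -[sqrtop G (D y)]/((sqrtop G \o D) y) GD.
have nG v := norm_sqrt_weighted v.
apply/eqP; rewrite eq_le; apply/andP; split.
  exact: (representer_norm_le nG (cD y) DC).
(* The reverse inequality needs C y in the closure of the smaller range of B11^(1/2) P, which
   density of range P provides. *)
apply: (@representer_norm_le _ _ _ _ (sqrtop B11 \o P) (sqrtop G)) => //.
apply: closure_range_comp => //; first exact/psd_bounded/psd_sqrtop.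
by move=> x; exact: injective_dense_range.
Qed.

(** The cross terms vanish: D takes values in the closure of range G^(1/2), which is orthogonal to
    its null space. *)
Lemma weighted_rootD_sqr (N : K2 -> K1) : bounded_op N ->
  range N `<=` nullspace (sqrtop G) ->
  adj (D + N) \o (D + N) = (adj C \o C) + (adj N \o N).
Proof.
move=> bN NG; have [bD _ cD] := weighted_root; rewrite -weighted_root_sqr.
have DN u v : inner (D u) (N v) = 0.
  by apply: (closure_range_null psdGs (cD u)); apply: NG; exists v.
apply/funext => u; apply: inner_ext => v; have bDN := bounded_add bD bN.
rewrite !fctE innerDl -!adjPr// ?fctE innerDl !innerDr DN (innerC (N u)) DN.
by rewrite addr0 add0r.
Qed.

End WeightedBlock.

(** * Operators in block form *)

Section BlockDecomposition.
Context (R : realType) (H : hilbertType R) (H1 H2 : closedSubspace H).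
Hypothesis orth : forall (u : H1) (v : H2), inner (val u) (val v) = 0.
Hypothesis split_sum : forall x, x = val (oproj H1 x) + val (oproj H2 x).

Lemma oproj1_val2 (v : H2) : oproj H1 (val v) = 0.
Proof. by apply: inner_ext => u; rewrite oprojP innerC orth inner0l. Qed.

Lemma oproj2_val1 (u : H1) : oproj H2 (val u) = 0.
Proof. by apply: inner_ext => v; rewrite oprojP orth inner0l. Qed.

Lemma block_comp (U W : closedSubspace H) (S T : H -> H) : linear S ->
  block U W (S \o T) = (block U H1 S \o block H1 W T) + (block U H2 S \o block H2 W T).
Proof.
move=> lS; apply/funext => x; rewrite !fctE /block /= {1}[T (val x)]split_sum.
by rewrite (linD lS) (linD (bounded_lin (bounded_oproj U))).
Qed.

Lemma of_blocks_block (M : H -> H) : linear M ->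
  of_blocks (block H1 H1 M) (block H1 H2 M) (block H2 H1 M) (block H2 H2 M) = M.
Proof.
move=> lM; apply/funext => x; rewrite /of_blocks /block.
have l1 := bounded_lin (bounded_oproj H1); have l2 := bounded_lin (bounded_oproj H2).
by rewrite -(linD l1) -(linD l2) -(linD lM) -split_sum -split_sum.
Qed.

Section OfBlocks.
Variables (a : H1 -> H1) (b : H2 -> H1) (c : H1 -> H2) (d : H2 -> H2).
Hypotheses (ba : bounded_op a) (bb : bounded_op b) (bc : bounded_op c)
  (bd : bounded_op d).

Let M := of_blocks a b c d.

Lemma oproj1_of_blocks x : oproj H1 (M x) = a (oproj H1 x) + b (oproj H2 x).
Proof.
rewrite (linD (bounded_lin (bounded_oproj H1))) oproj_val oproj1_val2; exact: addr0.
Qed.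

Lemma oproj2_of_blocks x : oproj H2 (M x) = c (oproj H1 x) + d (oproj H2 x).
Proof.
rewrite (linD (bounded_lin (bounded_oproj H2))) oproj_val oproj2_val1; exact: add0r.
Qed.

Lemma bounded_of_blocks : bounded_op M.
Proof.
have b1 := bounded_oproj H1; have b2 := bounded_oproj H2.
have h1 := bounded_add (bounded_comp ba b1) (bounded_comp bb b2).
have h2 := bounded_add (bounded_comp bc b1) (bounded_comp bd b2).
exact: bounded_add (bounded_comp (bounded_val H1) h1)
  (bounded_comp (bounded_val H2) h2).
Qed.

Lemma block11_of_blocks : block H1 H1 M = a.
Proof.
apply/funext => u; rewrite /block oproj1_of_blocks oproj_val oproj2_val1.
by rewrite (lin0 (bounded_lin bb)) addr0.
Qed.

Lemma block12_of_blocks : block H1 H2 M = b.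
Proof.
apply/funext => u; rewrite /block oproj1_of_blocks oproj_val oproj1_val2.
by rewrite (lin0 (bounded_lin ba)) add0r.
Qed.

Lemma block21_of_blocks : block H2 H1 M = c.
Proof.
apply/funext => u; rewrite /block oproj2_of_blocks oproj_val oproj2_val1.
by rewrite (lin0 (bounded_lin bd)) addr0.
Qed.

Lemma block22_of_blocks : block H2 H2 M = d.
Proof.
apply/funext => u; rewrite /block oproj2_of_blocks oproj_val oproj1_val2.
by rewrite (lin0 (bounded_lin bc)) add0r.
Qed.

End OfBlocks.

Lemma block_adj_comp (U W : closedSubspace H) (M : H -> H) : bounded_op M ->
  block U W (M \o adj M) = (block U H1 M \o adj (block W H1 M)) +
                           (block U H2 M \o adj (block W H2 M)).
Proof. by move=> bM; rewrite block_comp ?adj_block//; exact: bounded_lin. Qed.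

End BlockDecomposition.

(** * Solutions of the factorization equation *)

Section Solutions.
Context (R : realType) (H : hilbertType R) (A B : H -> H) (H1 H2 : closedSubspace H).
Hypotheses (psdA : psd A) (psdB : psd B).
Hypotheses (hH1 : carrier H1 = closure (range A)) (hH2 : carrier H2 = nullspace A).

Let P := sqrtop A.
Let psdP : psd P := psd_sqrtop psdA.
Let bP : bounded_op P := psd_bounded psdP.
Let lP : linear P := bounded_lin bP.

Lemma null_val (v : H2) : A (val v) = 0.
Proof. by have := set_mem (valP v); move: (val v) => x; rewrite hH2. Qed.

Lemma null_sqrt_val (v : H2) : P (val v) = 0.
Proof. exact/(sqrtop_eq0 _ psdA)/null_val. Qed.

Lemma range_null_orth (u : H1) (v : H2) : inner (val u) (val v) = 0.
Proof.
apply: (closure_range_null psdA); last exact: null_val.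
by have := set_mem (valP u); move: (val u) => x; rewrite hH1.
Qed.

Let p1v2 := oproj1_val2 range_null_orth.
Let p2v1 := oproj2_val1 range_null_orth.

Lemma range_null_split x : x = val (oproj H1 x) + val (oproj H2 x).
Proof.
(* The residual is orthogonal to every A z, so A r = 0 by symmetry and r lies in H2. *)
pose r := x - val (oproj H1 x).
have Ar : A r = 0.
  apply: inner_ext => z; rewrite inner0l (psdC psdA).
  have Az : carrier H1 (A z) by rewrite hH1; apply: subset_closure; exists z.
  pose u : H1 := exist _ (A z) (mem_set Az).
  by rewrite -[A z]/(val u) innerBl -oprojP subspace_innerE subrr.
have r2 : carrier H2 r by rewrite hH2.
pose v : H2 := exist _ r (mem_set r2).
have -> : oproj H2 x = v.
  have -> : x = val (oproj H1 x) + val v by rewrite addrC subrK.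
  by rewrite (linD (bounded_lin (bounded_oproj H2))) p2v1 oproj_val add0r.
by rewrite addrC subrK.
Qed.

Let P1 := block H1 H1 P.

(** P vanishes on H2 and is symmetric, so its range is orthogonal to H2. Hence compressing P to H1
    is restricting it, and compression commutes with the square root of A. *)
Lemma val_sqrt_block u : val (P1 u) = P (val u).
Proof.
rewrite [RHS]range_null_split (_ : oproj H2 _ = 0) ?addr0//.
by apply: inner_ext => v; rewrite oprojP (psdC psdP) null_sqrt_val inner0r inner0l.
Qed.

Lemma sqrt_block : sqrtop (block H1 H1 A) = P1.
Proof.
apply: sqrtop_unique; first exact: psd_block.
apply/funext => u; rewrite -[LHS]/(oproj H1 (P (val (P1 u)))).
by rewrite val_sqrt_block /P sqrtopK.
Qed.

Lemma sqrt_block_inj u : P1 u = 0 -> u = 0.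
Proof.
move=> Pu; have Pv : P (val u) = 0 by rewrite -val_sqrt_block Pu.
have /(sqrtop_eq0 _ psdA) u2 : sqrtop A (val u) = 0 by exact: Pv.
have v2 : carrier H2 (val u) by rewrite hH2.
apply: inner_eq0; exact: (range_null_orth u (exist _ (val u) (mem_set v2))).
Qed.

Lemma sqrt_via_block x : P x = val (P1 (oproj H1 x)).
Proof.
by rewrite val_sqrt_block {1}[x]range_null_split (linD lP) null_sqrt_val addr0.
Qed.

Let B11 := block H1 H1 B.
Let B12 := block H1 H2 B.
Let psdP1 : psd P1 := psd_block H1 psdP.
Let psdB11 : psd B11 := psd_block H1 psdB.
Let bB12 : bounded_op B12 := bounded_block H1 H2 (psd_bounded psdB).

(** Quantitative form of the inclusion of range B12 in range B11^(1/2): <B12 y, x> = <B^(1/2) y,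
    B^(1/2) x>, and |B^(1/2) x| = |B11^(1/2) x| for x in H1. *)
Lemma cross_block_le : exists2 c : R, 0 <= c &
  forall y x, `|inner (B12 y) x| <= c * `|y| * `|sqrtop B11 x|.
Proof.
have pS := psd_sqrtop psdB; have /bounded_opP[_ [c c0 hc]] := psd_bounded pS.
exists c => // y x; rewrite /B12 inner_block -(sqrtopK _ psdB) (psdC pS).
apply: le_trans (cauchy_schwarz _ _) _.
rewrite (@norm_sqrtop _ _ _ _ (sqrtop B \o (val : H1 -> H)) x psdB11) ?ler_wpM2r//.
by rewrite /= sqr_norm_sqrtop// /B11 inner_block.
Qed.

Let G := P1 \o B11 \o P1.
Let Q := pseudoinv P1 \o sqrtop G.
Let C := pseudoinv (sqrtop B11) \o B12.
Let D := pseudoinv (sqrtop G) \o P1 \o B12.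

Lemma solutionE (N : H2 -> H1) (M22 : H2 -> H2) :
  solution A B N M22 = of_blocks Q 0 (adj (D + N)) M22.
Proof. by rewrite /solution sqrt_block. Qed.

Lemma admissibleP (N : H2 -> H1) (M22 : H2 -> H2) : admissible A B N M22 <->
  [/\ bounded_op N, range N `<=` nullspace (sqrtop G),
      psd (schur H1 H2 B - (adj N \o N)), bounded_op M22
    & M22 \o adj M22 = schur H1 H2 B - (adj N \o N)].
Proof. by rewrite /admissible sqrt_block (null_sqrt_weighted psdP1 psdB11). Qed.

Let bQ : bounded_op Q := (weighted_map psdP1 psdB11).1.

Let P1Q u : P1 (Q u) = sqrtop G u.
Proof. by rewrite -[LHS]/((P1 \o Q) u) (weighted_map psdP1 psdB11).2. Qed.

Let bD : bounded_op D.
Proof.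
by have [c c0 hc] := cross_block_le; have [] := weighted_root psdP1 psdB11 bB12 c0 hc.
Qed.

Let GD y : sqrtop G (D y) = P1 (B12 y).
Proof.
have [c c0 hc] := cross_block_le; have [_ h _] := weighted_root psdP1 psdB11 bB12 c0 hc.
by rewrite -[LHS]/((sqrtop G \o D) y) h.
Qed.

Let DN_sqr N : bounded_op N -> range N `<=` nullspace (sqrtop G) ->
  adj (D + N) \o (D + N) = (adj C \o C) + (adj N \o N).
Proof.
have [c c0 hc] := cross_block_le.
exact: (weighted_rootD_sqr psdP1 sqrt_block_inj psdB11 bB12 c0 hc).
Qed.

Lemma bounded_solution (N : H2 -> H1) (M22 : H2 -> H2) : bounded_op N -> bounded_op M22 ->
  bounded_op (solution A B N M22).
Proof.
move=> bN bM; rewrite solutionE; apply: bounded_of_blocks => //.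
  exact: bounded_zero.
by apply: bounded_adj; exact: bounded_add.
Qed.

(** P sees only the first row (Q, 0), so the product is G^(1/2) on H1 and 0 on H2. *)
Lemma psd_sqrt_solution (N : H2 -> H1) (M22 : H2 -> H2) : psd (P \o solution A B N M22).
Proof.
have -> : P \o solution A B N M22 = @adj R H H1 (oproj H1) \o sqrtop G \o oproj H1.
  apply/funext => x /=; rewrite solutionE sqrt_via_block.
  by rewrite (oproj1_of_blocks range_null_orth) addr0 adj_oproj P1Q.
exact: (@psd_sandwich R H H1 _ _ (psd_sqrtop (psd_weighted psdP1 psdB11))
  (bounded_oproj H1)).
Qed.

Lemma solution_sqr (N : H2 -> H1) (M22 : H2 -> H2) : admissible A B N M22 ->
  solution A B N M22 \o adj (solution A B N M22) = B.
Proof.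
move=> /admissibleP[bN NG _ bM MM]; have bS := bounded_solution bN bM.
have b0 := @bounded_zero R H2 H1; have bDN := bounded_add bD bN.
have bMM := bounded_comp bS (bounded_adj bS).
have lB := bounded_lin (psd_bounded psdB).
rewrite -(of_blocks_block range_null_split (bounded_lin bMM)).
rewrite -[RHS](of_blocks_block range_null_split lB).
rewrite !(block_adj_comp range_null_split)//.
rewrite solutionE.
rewrite (block11_of_blocks range_null_orth)// (block12_of_blocks range_null_orth)//.
rewrite (block21_of_blocks range_null_orth) ?(block22_of_blocks range_null_orth)//;
  try exact: bounded_adj.
have z1 : (0 : H2 -> H1) \o adj M22 = 0 by [].
have z2 : (0 : H2 -> H1) \o adj (0 : H2 -> H1) = 0 by [].
have z3 : M22 \o adj (0 : H2 -> H1) = 0.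
  by apply/funext => x /=; rewrite adj_zero; exact: (lin0 (bounded_lin bM)).
(* Checked after applying the injective P1: G^(1/2) D = P1 B12 and G^(1/2) N = 0. *)
have QDN : Q \o (D + N) = B12.
  apply/funext => y; apply/eqP; rewrite -subr_eq0; apply/eqP/sqrt_block_inj.
  rewrite (linB (bounded_lin (psd_bounded psdP1))) /= P1Q.
  rewrite (linD (bounded_lin (psd_bounded (psd_sqrtop (psd_weighted psdP1 psdB11))))).
  have -> : sqrtop G (N y) = 0 by apply: NG; exists y.
  by rewrite GD addr0 subrr.
rewrite z1 z2 z3 !addr0 adjK// QDN (weighted_map_sqr psdP1 sqrt_block_inj psdB11).
congr of_blocks.
  by rewrite -adj_comp// QDN adj_block ?psd_adj//; exact: psd_bounded.
rewrite DN_sqr// MM /schur.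
by apply/funext => y; rewrite !fctE; inner_ring.
Qed.

Lemma solution_block22 (N : H2 -> H1) (M22 : H2 -> H2) :
  bounded_op N -> bounded_op M22 -> block H2 H2 (solution A B N M22) = M22.
Proof.
move=> bN bM; rewrite solutionE; apply: (block22_of_blocks range_null_orth).
by apply: bounded_adj; exact: bounded_add.
Qed.

Lemma solution_null (N : H2 -> H1) (v : H2) :
  bounded_op N -> solution A B N (0 : H2 -> H2) (val v) = 0.
Proof.
move=> bN; rewrite solutionE [LHS]range_null_split.
rewrite (oproj1_of_blocks range_null_orth) (oproj2_of_blocks range_null_orth) p1v2.
have -> : Q 0 + 0 = 0 by rewrite (lin0 (bounded_lin bQ)) addr0.
have -> : adj (D + N) 0 = 0.
  by apply: lin0; apply: bounded_lin; apply: bounded_adj; exact: bounded_add.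
have -> : 0 + (0 : H2 -> H2) (oproj H2 (val v)) = 0 by exact: addr0.
exact: addr0.
Qed.

Lemma solution_of_green M : bounded_op M -> M \o adj M = B -> psd (P \o M) ->
  exists (N : H2 -> H1) (M22 : H2 -> H2), admissible A B N M22 /\ M = solution A B N M22.
Proof.
move=> bM MB pPM; have lM := bounded_lin bM; have split := range_null_split.
pose M11 := block H1 H1 M; pose M21 := block H2 H1 M; pose M22 := block H2 H2 M.
have b11 : bounded_op M11 by exact: bounded_block.
have b21 : bounded_op M21 by exact: bounded_block.
have b22 : bounded_op M22 by exact: bounded_block.
(* Symmetry of P M gives <P M v, z> = <P v, M z> = 0 for v in H2, so M maps H2 into H2. *)
have M12 : block H1 H2 M = 0.
  apply/funext => v; apply: inner_ext => u; rewrite inner0l inner_block.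
  have Mv : P (M (val v)) = 0.
    apply: inner_ext => z; rewrite inner0l -[P _]/((P \o M) (val v)) (psdC pPM) /=.
    by rewrite -(psdC psdP) null_sqrt_val inner0l.
  have v2 : carrier H2 (M (val v)).
    by move/(sqrtop_eq0 _ psdA): Mv; move: (M _) => x Ax; rewrite hH2.
  pose w : H2 := exist _ (M (val v)) (mem_set v2).
  have := range_null_orth u w; rewrite innerC; exact.
have blk (U W : closedSubspace H) := block_adj_comp split U W bM.
have B11E : B11 = M11 \o adj M11.
  by rewrite /B11 -MB blk M12; apply/funext => x; rewrite !fctE addr0.
have B12E : B12 = M11 \o adj M21.
  by rewrite /B12 -MB blk M12; apply/funext => x; rewrite !fctE addr0.
have B22E : block H2 H2 B = (M21 \o adj M21) + (M22 \o adj M22) by rewrite -MB blk.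
have PM11E : P1 \o M11 = block H1 H1 (P \o M).
  apply/funext => u; apply: inner_ext => w; rewrite inner_block /= (psdC psdP1).
  by rewrite inner_block val_sqrt_block (psdC psdP).
(* P1 M11 is positive and its square is P1 M11 M11^* P1 = G, so uniqueness of the root identifies
   it. *)
have GM u : P1 (M11 u) = sqrtop G u.
  suff -> : sqrtop G = P1 \o M11 by [].
  have pPM11 : psd (P1 \o M11) by rewrite PM11E; exact: psd_block.
  apply: sqrtop_unique => //; rewrite -{2}(psd_adj pPM11) adj_comp//.
    by rewrite (psd_adj psdP1) /G B11E.
  exact: psd_bounded.
have M11E : M11 = Q.
  apply/funext => u; apply/eqP; rewrite -subr_eq0; apply/eqP/sqrt_block_inj.
  by rewrite (linB (bounded_lin (psd_bounded psdP1))) GM P1Q subrr.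
pose N := adj M21 - D.
have bN : bounded_op N.
  by apply: bounded_add; [exact: bounded_adj|exact: bounded_opp].
have DN : D + N = adj M21 by rewrite /N addrC subrK.
have NG : range N `<=` nullspace (sqrtop G).
  move=> _ [y _ <-]; change (sqrtop G (N y) = 0).
  have pG : psd (sqrtop G) := psd_sqrtop (psd_weighted psdP1 psdB11).
  have lG := bounded_lin (psd_bounded pG).
  have -> : sqrtop G (N y) = sqrtop G (adj M21 y) - sqrtop G (D y) by exact: linB.
  rewrite GD -GM.
  by rewrite -[M11 _]/((M11 \o adj M21) y) -B12E subrr.
have MM : M22 \o adj M22 = schur H1 H2 B - (adj N \o N).
  have := DN_sqr bN NG; rewrite DN adjK// => h.
  by rewrite /schur B22E h; apply/funext => y; rewrite !fctE; inner_ring.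
exists N, M22; split; last first.
  by rewrite solutionE DN adjK// -M11E -M12 of_blocks_block.
(* The condition on N^* N follows from the equation for M22, since M22 M22^* is positive. *)
apply/admissibleP; split=> //; rewrite -MM.
by have := psd_adj_comp (bounded_adj b22); rewrite adjK.
Qed.

End Solutions.

(** * Hilbert-Schmidt operators and traces *)

Section RealSums.
Context (R : realType) (T : choiceType).
Implicit Types (E : set T) (a b : T -> R) (s t : seq T).

(** Finite subsets as duplicate-free sequences, which allows induction on partial sums. *)
Definition finsub E s := uniq s /\ forall e, e \in s -> E e.

Lemma finsubU E s t : finsub E s -> finsub E t -> finsub E (undup (s ++ t)).
Proof.
move=> [_ sE] [_ tE]; split; first exact: undup_uniq.
by move=> e; rewrite mem_undup mem_cat => /orP[/sE|/tE].
Qed.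

Lemma sum_subseq_le E a s t : (forall e, E e -> 0 <= a e) -> finsub E s ->
  finsub E t -> {subset s <= t} -> \sum_(e <- s) a e <= \sum_(e <- t) a e.
Proof.
move=> a0 [us sE] [ut tE] st; rewrite [leRHS](bigID (fun e => e \in s)) /=.
have -> : \sum_(e <- t | e \in s) a e = \sum_(e <- s) a e.
  rewrite -big_filter; apply: perm_big; apply: uniq_perm => //.
    exact: filter_uniq.
  move=> e; rewrite mem_filter andb_idr//; exact: st.
rewrite lerDl big_seq_cond sumr_ge0// => e /andP[/tE Ee _]; exact: a0.
Qed.

Lemma sum_le_esum E a s : finsub E s ->
  ((\sum_(e <- s) a e)%:E <= \esum_(e in E) (a e)%:E)%E.
Proof.
move=> [us sE]; apply: esum_ge; exists [set` s]; last by rewrite -fsbig_seq// sumEFin.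
by split=> [|e /sE]; first exact: finite_seq.
Qed.

Lemma esum_le_bound E a c : (forall s, finsub E s -> \sum_(e <- s) a e <= c) ->
  (\esum_(e in E) (a e)%:E <= c%:E)%E.
Proof.
move=> h; apply: ge_ereal_sup => _ [A [finA AE] <-].
rewrite fsbig_finite//= sumEFin lee_fin; apply: h; split; first exact: finmap.fset_uniq.
by move=> e; rewrite in_fset_set// inE => /AE.
Qed.

Lemma esum_fin_numE E a : (forall e, E e -> 0 <= a e) ->
  (\esum_(e in E) (a e)%:E < +oo)%E ->
  \esum_(e in E) (a e)%:E = (fine (\esum_(e in E) (a e)%:E))%:E.
Proof.
by move=> a0 h; rewrite fineK// ge0_fin_numE//; apply: esum_ge0 => e /a0; rewrite lee_fin.
Qed.

Lemma esum_dominated E a b (k : R) : 0 <= k -> (forall e, E e -> 0 <= a e) ->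
  (forall e, E e -> b e <= k * a e) ->
  (\esum_(e in E) (a e)%:E < +oo)%E -> (\esum_(e in E) (b e)%:E < +oo)%E.
Proof.
move=> k0 a0 ba fa; set c := fine (\esum_(e in E) (a e)%:E).
apply: (@le_lt_trans _ _ (k * c)%:E); last exact: ltry.
apply: esum_le_bound => s sE; apply: (@le_trans _ _ (\sum_(e <- s) k * a e)).
  rewrite big_seq [leRHS]big_seq; apply: ler_sum => e es; apply: ba; exact: sE.2.
rewrite -mulr_sumr ler_wpM2l// -lee_fin /c -esum_fin_numE//; exact: sum_le_esum.
Qed.

Lemma esumD_lty E a b : (forall e, E e -> 0 <= a e) -> (forall e, E e -> 0 <= b e) ->
  (\esum_(e in E) (a e)%:E < +oo)%E -> (\esum_(e in E) (b e)%:E < +oo)%E ->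
  (\esum_(e in E) (a e + b e)%:E < +oo)%E.
Proof.
move=> a0 b0 fa fb; under eq_esum do rewrite EFinD.
by rewrite esumD// ?lte_add_pinfty// => e Ee; rewrite lee_fin ?a0 ?b0.
Qed.

Lemma esum_adherent E a (eps : R) : (forall e, E e -> 0 <= a e) -> 0 < eps ->
  (\esum_(e in E) (a e)%:E < +oo)%E ->
  exists2 s, finsub E s & (\esum_(e in E) (a e)%:E < (\sum_(e <- s) a e + eps)%:E)%E.
Proof.
move=> a0 e0 fa; have fin : \esum_(e in E) (a e)%:E \is a fin_num.
  by rewrite esum_fin_numE.
have [_ [A [finA AE] <-] h] := ub_ereal_sup_adherent e0 fin.
exists (finmap.enum_fset (fset_set A)); first by split; [exact: finmap.fset_uniq|
  move=> e; rewrite in_fset_set// inE => /AE].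
by move: h; rewrite lteBlDr// fsbig_finite//= sumEFin -EFinD.
Qed.

End RealSums.

Section Parseval.
Context (R : realType) (H : hilbertType R) (E : set H).
Hypothesis basisE : orthonormal_basis E.
Implicit Types (s t : seq H) (x y : H).

Definition seqproj s x := \sum_(e <- s) inner x e *: e.

Lemma inner_seqproj s x f : inner (seqproj s x) f = \sum_(e <- s) inner x e * inner e f.
Proof.
rewrite /seqproj; elim: s => [|e s IH]; first by rewrite !big_nil inner0l.
by rewrite !big_cons innerDl innerZl IH.
Qed.

Lemma inner_seqproj_out s x f : finsub E s -> E f -> f \notin s ->
  inner (seqproj s x) f = 0.
Proof.
move=> [_ sE] Ef fs; rewrite inner_seqproj big_seq big1// => e es.
have [_ o _] := basisE; rewrite (o e f (sE e es) Ef) ?mulr0//.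
by apply: contraNneq fs => <-.
Qed.

Lemma sqr_norm_residual s x : finsub E s ->
  `|x - seqproj s x| ^+ 2 = `|x| ^+ 2 - \sum_(e <- s) inner x e ^+ 2.
Proof.
elim: s => [|e s IH] [us sE]; first by rewrite /seqproj !big_nil !subr0.
have [n1 _ _] := basisE; move: us => /= /andP[es us].
have fs : finsub E s by split=> // f fs; apply: sE; rewrite inE fs orbT.
have Ee : E e by apply: sE; rewrite mem_head.
rewrite /seqproj !big_cons -/(seqproj s x) opprD addrCA addrC sqr_normB IH//.
rewrite innerZr innerBl inner_seqproj_out// subr0 -[X in _ + X]inner_normE.
by rewrite innerZl innerZr n1//; ring.
Qed.

Lemma seqproj_lin s : linear (seqproj s).
Proof.
move=> a x y; apply: inner_ext => z; rewrite innerDl innerZl !inner_seqproj.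
rewrite mulr_sumr -big_split; apply: eq_bigr => e _ /=.
by rewrite innerDl innerZl; ring.
Qed.

Lemma residual_le s t x : finsub E s -> finsub E t -> {subset s <= t} ->
  `|x - seqproj t x| <= `|x - seqproj s x|.
Proof.
move=> fs ft st; apply: le_of_sqr_le => //; rewrite !sqr_norm_residual// lerD2l lerN2.
by apply: (@sum_subseq_le _ _ E) => // e _; exact: sqr_ge0.
Qed.

Lemma residual_le_norm s x : finsub E s -> `|x - seqproj s x| <= `|x|.
Proof.
move=> fs; apply: le_of_sqr_le => //; rewrite sqr_norm_residual// gerBl.
by rewrite sumr_ge0// => e _; exact: sqr_ge0.
Qed.

Lemma bessel s x : finsub E s -> \sum_(e <- s) inner x e ^+ 2 <= `|x| ^+ 2.
Proof. by move=> /(sqr_norm_residual x) h; rewrite -subr_ge0 -h sqr_ge0. Qed.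

Let approx : set H :=
  [set x | forall d : R, 0 < d -> exists2 s, finsub E s & `|x - seqproj s x| < d].

Let approx0 : approx 0.
Proof.
move=> d d0; exists [::] => //; by rewrite /seqproj big_nil subr0 normr0.
Qed.

Let approxDZ (a : R) x y : approx x -> approx y -> approx (a *: x + y).
Proof.
move=> ax ay d d0; have a1 : 0 < 2 * (`|a| + 1) by have := normr_ge0 a; lra.
have [s fs xs] := ax _ (divr_gt0 d0 a1).
have [t ft yt] := ay _ (divr_gt0 d0 (ltr0n _ 2)).
have fu := finsubU fs ft; exists (undup (s ++ t)) => //; set u := undup _ in fu *.
have xu : `|x - seqproj u x| <= `|x - seqproj s x|.
  by apply: residual_le => // e es; rewrite mem_undup mem_cat es.
have yu : `|y - seqproj u y| <= `|y - seqproj t y|.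
  by apply: residual_le => // e et; rewrite mem_undup mem_cat et orbT.
rewrite seqproj_lin opprD addrACA -scalerBr; apply: le_lt_trans (ler_normD _ _) _.
have hh : (`|a| + 1) * (d / (2 * (`|a| + 1))) = d / 2.
  by field; have := normr_ge0 a; lra.
have := normr_ge0 a; have := normr_ge0 (x - seqproj u x); rewrite normrZ; nra.
Qed.

Let approx_closed : closed approx.
Proof.
move=> x /closure_normP cx d d0.
have [z az xz] := cx _ (divr_gt0 d0 (ltr0n _ 2)).
have [s fs zs] := az _ (divr_gt0 d0 (ltr0n _ 2)).
exists s => //; have -> : x - seqproj s x =
    ((x - z) - seqproj s (x - z)) + (z - seqproj s z).
  by rewrite (linB (@seqproj_lin s)); inner_ring.
apply: le_lt_trans (ler_normD _ _) _; have := residual_le_norm (x - z) fs; lra.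
Qed.

(** Completeness of a basis is stated as maximality. The vectors approximated by finite expansions
    form a closed subspace containing E; what remains of x after projecting onto it is orthogonal to
    E, hence zero. *)
Lemma basis_approx x (d : R) : 0 < d -> exists2 s, finsub E s & `|x - seqproj s x| < d.
Proof.
pose W := ClosedSubspace approx0 approxDZ approx_closed.
have [n1 o full] := basisE.
suff ax : approx x by exact: ax.
have -> : x = val (oproj W x).
  apply/eqP; rewrite -subr_eq0; apply/eqP/full => e Ee.
  have ae : approx e.
    move=> c c0; exists [:: e]; first by split=> // f; rewrite inE => /eqP ->.
    by rewrite /seqproj big_seq1 n1// scale1r subrr normr0.
  pose w : W := exist _ e (mem_set ae).
  by rewrite innerBl -[e]/(val w) -oprojP subspace_innerE subrr.
exact: (set_mem (valP (oproj W x))).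
Qed.

Lemma parseval x : \esum_(e in E) (inner x e ^+ 2)%:E = (`|x| ^+ 2)%:E.
Proof.
apply/eqP; rewrite eq_le; apply/andP; split.
  by apply: esum_le_bound => s; exact: bessel.
apply/lee_addgt0Pr => d d0.
have sd0 : 0 < Num.sqrt d by rewrite sqrtr_gt0.
have [s fs xs] := basis_approx x sd0.
have : (`|x| ^+ 2 <= \sum_(e <- s) inner x e ^+ 2 + d).
  have : `|x - seqproj s x| ^+ 2 <= d.
    have sd : Num.sqrt d ^+ 2 = d by rewrite sqr_sqrtr// ltW.
    have := normr_ge0 (x - seqproj s x); nra.
  by rewrite sqr_norm_residual//; lra.
rewrite -lee_fin EFinD => /le_trans; apply; rewrite leeD2r//; exact: sum_le_esum.
Qed.

End Parseval.

Section HilbertSchmidt.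
Context (R : realType).
Implicit Types H K : hilbertType R.

(** Parseval in F turns a finite sum over E into a double sum of <T e, f>^2; after exchanging the
    sums, Bessel in E bounds the inner one by |T^* f|^2. *)
Let hs_adj_le H K (T : H -> K) (E : set H) (F : set K) : bounded_op T ->
  orthonormal_basis E -> orthonormal_basis F ->
  (\esum_(e in E) (`|T e| ^+ 2)%:E <= \esum_(f in F) (`|adj T f| ^+ 2)%:E)%E.
Proof.
move=> bT bE bF; apply: ge_ereal_sup => _ [A [finA AE] <-].
rewrite fsbig_finite//=; set s := finmap.enum_fset _.
have fs : finsub E s.
  by split; [exact: finmap.fset_uniq|move=> e; rewrite in_fset_set// inE => /AE].
under eq_bigr do rewrite -(parseval bF).
rewrite -esum_sum; last by move=> *; rewrite lee_fin sqr_ge0.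
apply: le_esum => f Ff; rewrite sumEFin lee_fin.
under eq_bigr do rewrite adjP// innerC.
exact: (bessel bE).
Qed.

Lemma hs_adj H K (T : H -> K) (E : set H) (F : set K) : bounded_op T ->
  orthonormal_basis E -> orthonormal_basis F ->
  \esum_(e in E) (`|T e| ^+ 2)%:E = \esum_(f in F) (`|adj T f| ^+ 2)%:E.
Proof.
move=> bT bE bF; apply/eqP; rewrite eq_le hs_adj_le//=.
by rewrite -{2}(adjK bT) hs_adj_le//; exact: bounded_adj.
Qed.

Lemma hs_basis H (T : H -> H) (E F : set H) : bounded_op T ->
  orthonormal_basis E -> orthonormal_basis F ->
  \esum_(e in E) (`|T e| ^+ 2)%:E = \esum_(f in F) (`|T f| ^+ 2)%:E.
Proof. by move=> bT bE bF; rewrite (hs_adj bT bE bF) -(hs_adj bT bF bF). Qed.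

End HilbertSchmidt.

(** * Compactness of Hilbert-Schmidt operators *)

Section Compactness.
Context (R : realType).
Implicit Types H K : hilbertType R.

Lemma compact_bounded_op H K (M : H -> K) : compact_op M -> bounded_op M.
Proof.
move=> [lM]; rewrite precompactE => /compact_bounded[c [_ hc]].
apply/bounded_opP; split=> //; pose k := `|c| + 1; exists k.
  by rewrite /k addr_ge0.
have ck : c < k by rewrite /k (le_lt_trans (ler_norm c))// ltrDl.
move=> x; have [->|x0] := eqVneq x 0; first by rewrite (lin0 lM) !normr0 mulr0.
have nx : 0 < `|x| by rewrite normr_gt0.
have : `|M (`|x|^-1 *: x)| <= k.
  apply: (hc k ck); apply: subset_closure; exists (`|x|^-1 *: x) => //=.
  by rewrite normrZ normfV normr_id mulVf// gt_eqF.
by rewrite (linZ lM) normrZ normfV normr_id ler_pdivrMl// mulrC.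
Qed.

Lemma norm_basis H (E : set H) e : orthonormal_basis E -> E e -> `|e| = 1.
Proof.
move=> [n1 _ _] /n1 /eqP; rewrite inner_normE sqrf_eq1 => /orP[/eqP //|/eqP h].
by have := normr_ge0 e; rewrite h; lra.
Qed.

(* An ultrafilter on closure S converges in each coordinate, hence is Cauchy
   because finitely many coordinates determine a point of closure S up to d. *)
Lemma precompact_uniform_residual H (E : set H) (S : set H) (c : R) :
  orthonormal_basis E -> (forall y, S y -> `|y| <= c) ->
  (forall d : R, 0 < d -> exists2 s, finsub E s &
     forall y, S y -> `|y - seqproj s y| <= d) ->
  precompact S.
Proof.
move=> bE Sc Sres; rewrite precompactE compact_ultra => F FU FS /=.
have PF : ProperFilter F by exact: ultra_proper.
have clc y : closure S y -> `|y| <= c.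
  move=> /closure_normP cy; apply/ler_addgt0Pr => d d0; have [z Sz yz] := cy d d0.
  by have := Sc z Sz; have := ler_normD (y - z) z; rewrite subrK; lra.
have clres (d : R) : 0 < d -> exists2 s, finsub E s &
    forall y, closure S y -> `|y - seqproj s y| <= d.
  move=> d0; have [s fs hs] := Sres (d / 2) (divr_gt0 d0 (ltr0n _ 2)).
  exists s => // y /closure_normP/(_ _ (divr_gt0 d0 (ltr0n _ 2)))[z Sz yz].
  have -> : y - seqproj s y = ((y - z) - seqproj s (y - z)) + (z - seqproj s z).
    by rewrite (linB (@seqproj_lin _ _ s)); inner_ring.
  have := residual_le_norm bE (y - z) fs; have := hs z Sz.
  by have := ler_normD ((y - z) - seqproj s (y - z)) (z - seqproj s z); lra.
have coord e (d : R) : E e -> 0 < d -> exists2 A, F A &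
    forall y z, A y -> A z -> `|inner (y - z) e| <= d.
  move=> Ee d0; have GK : ((inner^~ e) @ F) [set` `[- c, c]].
    apply: (@filterS _ F _ (closure S)) FS => y /clc yc; rewrite /= in_itv /= -ler_norml.
    apply: le_trans (cauchy_schwarz _ _) _.
    by rewrite (norm_basis bE Ee) mulr1.
  have [l [_ cl]] := segment_compact (fmap_proper_filter (inner^~ e) PF) GK.
  pose U := [set y : H | `|l - inner y e| < d / 2].
  exists U; last first.
    move=> y z; rewrite /U /= innerBl => yl zl.
    have := ler_distD l (inner y e) (inner z e).
    by rewrite (distrC (inner y e) l); lra.
  (* If the complement of U were in F, the cluster point l would have a coordinate from that
     complement within d / 2 of it, against the definition of U. *)
  have [//|FnU] := in_ultra_setVsetC U FU.
  have FnU' : ((inner^~ e) @ F) [set inner y e | y in ~` U].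
    by apply: (@filterS _ F _ (~` U)) FnU => y Uy; exists y.
  have [_ [[y nUy <-]]] := cl _ _ FnU' (nbhsx_ballx l (d / 2) (divr_gt0 d0 (ltr0n _ 2))).
  by move=> /nUy.
have coords s (d : R) : (forall e, e \in s -> E e) -> 0 < d -> exists2 A, F A &
    forall y z, A y -> A z -> `|seqproj s (y - z)| <= d.
  elim: s d => [|e s IH] d sE d0.
    exists setT; first exact: filterT.
    by move=> y z _ _; rewrite /seqproj big_nil normr0 ltW.
  have d2 : 0 < d / 2 by exact: divr_gt0.
  have [A FA hA] := IH (d / 2) (fun f fs => sE f (mem_behead (s := e :: s) fs)) d2.
  have Ee : E e by apply: sE; rewrite mem_head.
  have [U FUU hU] := coord e (d / 2) Ee d2.
  exists (A `&` U); first exact: filterI.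
  move=> y z [Ay Uy] [Az Uz]; rewrite /seqproj big_cons -/(seqproj s (y - z)).
  apply: le_trans (ler_normD _ _) _; rewrite normrZ (norm_basis bE Ee).
  by have := hA y z Ay Az; have := hU y z Uy Uz; lra.
have /cauchy_cvg Fl : cauchy F.
  apply/cauchy_ballP => d d0; have d4 : 0 < d / 4 by exact: divr_gt0.
  have [s fs hs] := clres _ d4; have [A FA hA] := coords s _ fs.2 d4.
  exists (A `&` closure S, A `&` closure S); first by split; exact: filterI.
  move=> [y z] /= [[Ay Sy] [Az Sz]]; rewrite -ball_normE /=.
  have -> : y - z = (y - seqproj s y) - (z - seqproj s z) + seqproj s (y - z).
    by rewrite (linB (@seqproj_lin _ _ s)); inner_ring.
  apply: le_lt_trans (ler_normD _ _) _.
  have := ler_normB (y - seqproj s y) (z - seqproj s z).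
  have := hs y Sy; have := hs z Sz; have := hA y z Ay Az; lra.
exists (lim F); split; last exact: Fl.
apply: (@closed_closure _ S) => U Ul; have FUS : F (U `&` closure S).
  by apply: filterI => //; exact: Fl.
by have [y [Uy Sy]] := filter_ex FUS; exists y.
Qed.

(** Since <M x, e> = <x, M^* e>, the part of M x outside s has squared norm at most the tail of the
    sum of |M^* e|^2, uniformly over the unit ball. *)
Lemma hs_adj_compact H K (M : H -> K) (E : set K) : orthonormal_basis E ->
  bounded_op M -> (\esum_(e in E) (`|adj M e| ^+ 2)%:E < +oo)%E -> compact_op M.
Proof.
move=> bE bM fM; have /bounded_opP[lM [c c0 hc]] := bM; split=> //.
apply: (@precompact_uniform_residual _ E _ c bE).
  by move=> _ [x /= x1 <-]; apply: le_trans (hc x) _; rewrite ler_piMr.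
move=> d d0; have d2 : 0 < d ^+ 2 by exact: exprn_gt0.
have a0 e : E e -> 0 <= `|adj M e| ^+ 2 by move=> _; exact: sqr_ge0.
have [s fs hs] := esum_adherent a0 d2 fM.
exists s => // _ [x /= x1 <-]; apply/ler_addgt0Pr => r r0.
(* The tail is compared on a finite set u containing s and t only; t depends on x, but it leaves an
   error r that is arbitrary. *)
have [t ft ht] := basis_approx bE (M x) r0.
have fu := finsubU fs ft; set u := undup _ in fu.
have su : {subset s <= u} by move=> e es; rewrite mem_undup mem_cat es.
have tu : {subset t <= u} by move=> e et; rewrite mem_undup mem_cat et orbT.
have ru : `|M x - seqproj u (M x)| <= r.
  exact: le_trans (residual_le bE _ ft fu tu) (ltW ht).
have ab : \sum_(e <- s) (`|adj M e| ^+ 2 - inner (M x) e ^+ 2) <=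
          \sum_(e <- u) (`|adj M e| ^+ 2 - inner (M x) e ^+ 2).
  apply: (@sum_subseq_le _ _ E) => // e _; rewrite subr_ge0 adjP//.
  rewrite -[leLHS]real_normK ?num_real//.
  rewrite ler_pXn2r ?nnegrE//; apply: le_trans (cauchy_schwarz _ _) _.
  by rewrite ler_piMl.
have au : \sum_(e <- u) `|adj M e| ^+ 2 <= \sum_(e <- s) `|adj M e| ^+ 2 + d ^+ 2.
  by rewrite -lee_fin; apply: le_trans (sum_le_esum _ fu) (ltW hs).
apply: le_of_sqr_le; first by rewrite addr_ge0 ?ltW.
have : `|M x - seqproj u (M x)| ^+ 2 <= r ^+ 2 by rewrite ler_pXn2r ?nnegrE// ltW.
move: ab; rewrite !sumrB !(sqr_norm_residual bE)//; nra.
Qed.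

End Compactness.

(** * Traces of products of Hilbert-Schmidt operators *)

Section Traces.
Context (R : realType) (H : hilbertType R).
Implicit Types (X Y T C : H -> H) (E : set H).

Definition hs_op X := forall E, orthonormal_basis E ->
  (\esum_(e in E) (`|X e| ^+ 2)%:E < +oo)%E.

Lemma hs_op_adj X : bounded_op X -> hs_op X -> hs_op (adj X).
Proof. by move=> bX hX E bE; rewrite -(hs_adj bX bE bE); exact: hX. Qed.

Lemma hs_op_of_basis X E : bounded_op X -> orthonormal_basis E ->
  (\esum_(e in E) (`|X e| ^+ 2)%:E < +oo)%E -> hs_op X.
Proof. by move=> bX bE hX F bF; rewrite (hs_basis bX bF bE). Qed.

Lemma hs_op_le X Y Z : hs_op X -> hs_op Y ->
  (forall x, `|Z x| <= `|X x| + `|Y x|) -> hs_op Z.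
Proof.
move=> hX hY ZXY E bE.
have a0 e : E e -> 0 <= `|X e| ^+ 2 + `|Y e| ^+ 2.
  by move=> _; rewrite addr_ge0 ?sqr_ge0.
apply: (@esum_dominated _ _ _ (fun e => `|X e| ^+ 2 + `|Y e| ^+ 2) _ 2) => //.
  move=> e _; have := ZXY e; have := normr_ge0 (Z e); have := normr_ge0 (X e).
  have := normr_ge0 (Y e); have := sqr_ge0 (`|X e| - `|Y e|); nra.
by apply: esumD_lty; [move=> *; exact: sqr_ge0|move=> *; exact: sqr_ge0|exact: hX|exact: hY].
Qed.

Lemma psd_abs C : psd C -> sqrtop (adj C \o C) = C.
Proof. by move=> pC; apply: sqrtop_unique => //; rewrite psd_adj. Qed.

Lemma trace_class_psd_sqrt C : trace_class_psd C -> hs_op (sqrtop C).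
Proof.
move=> [pC [_ [E bE]]]; rewrite psd_abs// => fC.
apply: (hs_op_of_basis _ bE); first exact/psd_bounded/psd_sqrtop.
by under eq_esum do rewrite sqr_norm_sqrtop//.
Qed.

(** |M^* e|^2 = <B e, e> = |B^(1/2) e|^2. *)
Lemma green_hs B M : trace_class_psd B -> bounded_op M -> M \o adj M = B ->
  hs_op (adj M).
Proof.
move=> tB bM MB E bE; have := trace_class_psd_sqrt tB bE.
suff -> : (fun e => (`|adj M e| ^+ 2)%:E) = (fun e => (`|sqrtop B e| ^+ 2)%:E) by [].
apply/funext => e; rewrite (sqr_norm_sqrtop e (proj1 tB)) -MB /=.
by rewrite adjP// inner_normE.
Qed.

(* |T| = U T for a contraction U, so <|T| e, e> = <Y e, X U^* e> when T = X^* Y. *)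
Lemma hs_comp_trace_class X Y E : orthonormal_basis E -> bounded_op X ->
  bounded_op Y -> hs_op X -> hs_op Y -> trace_class (adj X \o Y).
Proof.
move=> bE bX bY hX hY; have baX := bounded_adj bX.
pose T := adj X \o Y; have bT : bounded_op T by exact: bounded_comp.
have pTT := psd_adj_comp bT; split=> //; exists E => //.
rewrite -/T; set L := sqrtop _; have bL : bounded_op L by exact/psd_bounded/psd_sqrtop.
have LT x : `|L x| <= 1 * `|T x|.
  by rewrite mul1r (@norm_sqrtop _ _ _ _ T)//= -adjPr// inner_normE.
have [U bU LU] := douglas ler01 bT bL LT.
have [_ [c c0 hc]] := (bounded_opP U).1 bU.
have baU := bounded_adj bU; have bXU := bounded_comp bX baU.
have fXU : (\esum_(e in E) (`|(X \o adj U) e| ^+ 2)%:E < +oo)%E.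
  rewrite (hs_adj bXU bE bE) adj_comp// adjK//.
  apply: (@esum_dominated _ _ _ (fun e => `|adj X e| ^+ 2) _ (c ^+ 2)).
  - exact: sqr_ge0.
  - by move=> e _; exact: sqr_ge0.
  - move=> e _; rewrite -exprMn ler_pXn2r ?nnegrE ?mulr_ge0//; exact: hc.
  - exact: (hs_op_adj bX hX).
have a0 e : E e -> 0 <= `|Y e| ^+ 2 + `|(X \o adj U) e| ^+ 2.
  by move=> _; rewrite addr_ge0 ?sqr_ge0.
apply: (@esum_dominated _ _ _
  (fun e => `|Y e| ^+ 2 + `|(X \o adj U) e| ^+ 2) _ 1) => //.
  move=> e _; rewrite LU /= adjP// -adjPr// mul1r.
  have := inner_le (Y e) (X (adj U e)).
  have := sqr_ge0 (`|Y e| - `|X (adj U e)|); have := sqr_ge0 (`|Y e|).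
  by have := sqr_ge0 (`|X (adj U e)|); nra.
apply: esumD_lty fXU; [by move=> *; exact: sqr_ge0|by move=> *; exact: sqr_ge0|exact: hY].
Qed.

Definition half_sum X Y : H -> H := fun x => 2^-1 *: (X x + Y x).
Definition half_diff X Y : H -> H := fun x => 2^-1 *: (X x - Y x).

Lemma bounded_half_sum X Y : bounded_op X -> bounded_op Y ->
  bounded_op (half_sum X Y) /\ adj (half_sum X Y) = half_sum (adj X) (adj Y).
Proof.
move=> bX bY; split; last first.
  apply: adj_unique => x y; rewrite /half_sum innerZl innerZr innerDl innerDr.
  by rewrite !adjP.
have /bounded_opP[l [c c0 hc]] := bounded_add bX bY.
apply/bounded_opP; split; last first.
  exists c => // x; rewrite normrZ gtr0_norm ?invr_gt0//.
  by have := hc x; have := normr_ge0 (X x + Y x); rewrite fctE; lra.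
by move=> a x y; rewrite /half_sum (bounded_lin bX) (bounded_lin bY); inner_ring.
Qed.

Lemma bounded_half_diff X Y : bounded_op X -> bounded_op Y ->
  bounded_op (half_diff X Y) /\ adj (half_diff X Y) = half_diff (adj X) (adj Y).
Proof.
move=> bX bY; have := bounded_half_sum bX (bounded_opp bY).
by rewrite adj_opp.
Qed.

Lemma hs_half_sum X Y : hs_op X -> hs_op Y -> hs_op (half_sum X Y).
Proof.
move=> hX hY; apply: hs_op_le hX hY _ => x; rewrite normrZ gtr0_norm ?invr_gt0//.
by have := ler_normD (X x) (Y x); have := normr_ge0 (X x + Y x); lra.
Qed.

Lemma hs_half_diff X Y : hs_op X -> hs_op Y -> hs_op (half_diff X Y).
Proof.
move=> hX hY; apply: hs_op_le hX hY _ => x; rewrite normrZ gtr0_norm ?invr_gt0//.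
by have := ler_normB (X x) (Y x); have := normr_ge0 (X x - Y x); lra.
Qed.

(* Defined by polarisation, so that only sums of nonnegative terms occur. *)
Definition hs_inner E X Y : R :=
  fine (\esum_(e in E) (`|half_sum X Y e| ^+ 2)%:E) -
  fine (\esum_(e in E) (`|half_diff X Y e| ^+ 2)%:E).

Lemma hs_has_trace X Y E : orthonormal_basis E -> bounded_op X -> bounded_op Y ->
  hs_op X -> hs_op Y -> has_trace (adj X \o Y) (hs_inner E X Y).
Proof.
move=> bE bX bY hX hY; split; first exact: (hs_comp_trace_class bE).
move=> F bF /=.
have [bS _] := bounded_half_sum bX bY; have [bD _] := bounded_half_diff bX bY.
pose f e : \bar R := (`|half_sum X Y e| ^+ 2)%:E.
pose g e : \bar R := (`|half_diff X Y e| ^+ 2)%:E.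
(* Polarisation of <Y e, X e>. With f and g nonnegative and summable, the positive and negative
   parts of the diagonal may be replaced by f and g, whose sums do not depend on the basis. *)
have -> : (fun e => (inner (adj X (Y e)) e)%:E) = (f \- g)%E.
  apply/funext => e; rewrite /f /g -EFinB; congr EFin.
  rewrite /half_sum /half_diff -!inner_normE !innerZl !innerZr.
  by rewrite !innerDl !innerDr !innerNl !innerNr -adjPr// (innerC (Y e)); field.
have f0 e : (0 <= f e)%E by rewrite lee_fin sqr_ge0.
have g0 e : (0 <= g e)%E by rewrite lee_fin sqr_ge0.
have hf := hs_half_sum hX hY bF; have hg := hs_half_diff hX hY bF.
rewrite esumB//; last 2 first.
- by rewrite /summable; under eq_esum do rewrite gee0_abs//.
- by rewrite /summable; under eq_esum do rewrite gee0_abs//.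
rewrite /hs_inner EFinB; congr (_ - _)%E.
  rewrite -(hs_basis bS bF bE) -esum_fin_numE// => e _; exact: sqr_ge0.
rewrite -(hs_basis bD bF bE) -esum_fin_numE// => e _; exact: sqr_ge0.
Qed.

Lemma hs_inner_adj X Y E : orthonormal_basis E -> bounded_op X -> bounded_op Y ->
  hs_inner E (adj X) (adj Y) = hs_inner E X Y.
Proof.
move=> bE bX bY; have [bS aS] := bounded_half_sum bX bY.
have [bD aD] := bounded_half_diff bX bY.
by rewrite /hs_inner -aS -aD -(hs_adj bS bE bE) -(hs_adj bD bE bE).
Qed.

Lemma hs_innerC X Y E : hs_inner E X Y = hs_inner E Y X.
Proof.
rewrite /hs_inner; congr (fine _ - fine _); apply: eq_esum => e _; congr (_ ^+ 2)%:E.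
  by rewrite /half_sum addrC.
by rewrite /half_diff -opprB scalerN normrN.
Qed.

End Traces.

(** * Monge maps *)

Section MongeMaps.
Context (R : realType) (H : hilbertType R) (A B M : H -> H).
Hypotheses (hA : trace_class_psd A) (hB : trace_class_psd B).
Hypotheses (bM : bounded_op M) (MB : M \o adj M = B) (psdPM : psd (sqrtop A \o M)).

Lemma green_compact : green B M.
Proof.
have [_ [_ [E bE _]]] := hB; split=> //.
exact: hs_adj_compact bE bM (green_hs hB bM MB bE).
Qed.

(** All three traces are the Hilbert-Schmidt product of P = A^(1/2) and M. The first operator is P M
    = P^* M. The second is T A = M P, whose trace is the product of M^* and P, equal by invariance
    under adjoints. The third is again P M, a positive operator with square P M M^* P = P B P. *)
Lemma optimal_prepushforward_factor (T : H -> H) :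
  linear_on (range (sqrtop A)) T -> T \o sqrtop A = M -> optimal_prepushforward A B T.
Proof.
move=> linT TP; have psdP := psd_sqrtop hA.1; have bP := psd_bounded psdP.
have hsP := trace_class_psd_sqrt hA.
have hsM : hs_op M.
  by rewrite -(adjK bM); apply: hs_op_adj; [exact: bounded_adj|exact: green_hs hB _ _].
have [_ [_ [E bE _]]] := hB.
split=> //; [by rewrite TP|by rewrite TP|exists (hs_inner E (sqrtop A) M)].
have tPM : has_trace (sqrtop A \o M) (hs_inner E (sqrtop A) M).
  by rewrite -{1}(psd_adj psdP); exact: hs_has_trace.
split=> //; first by move: tPM; rewrite -{1}TP.
- have -> : T \o A = adj (adj M) \o sqrtop A.
    by rewrite adjK// -TP; apply/funext => x /=; rewrite sqrtopK//; exact: hA.1.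
  have -> : hs_inner E (sqrtop A) M = hs_inner E (adj M) (sqrtop A).
    by rewrite -(hs_inner_adj bE bP bM) hs_innerC (psd_adj psdP).
  by apply: hs_has_trace => //; [exact: bounded_adj|exact: hs_op_adj].
- have -> : sqrtop (sqrtop A \o B \o sqrtop A) = sqrtop A \o M => //.
  apply: sqrtop_unique => //; rewrite -{2}(psd_adj psdPM) adj_comp//.
  by rewrite (psd_adj psdP) -MB.
Qed.

End MongeMaps.

Theorem theorem6p9 (R : realType) (H : hilbertType R) (sepH : separable_space H)
    (A B : H -> H) (hA : trace_class_psd A) (hB : trace_class_psd B)
    (hAB : reachable A B)
    (H1 H2 : closedSubspace H)
    (hH1 : carrier H1 = closure (range A))
    (hH2 : carrier H2 = nullspace A) :
  [set M : H -> H | green B M /\ psd (sqrtop A \o M)] =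
  [set M : H -> H | exists (N12 : H2 -> H1) (M22 : H2 -> H2),
     admissible A B N12 M22 /\ M = solution A B N12 M22]
  /\
  forall (N12 : H2 -> H1) (M22 : H2 -> H2), admissible A B N12 M22 ->
    ((exists T : H -> H, optimal_prepushforward A B T /\
                         solution A B N12 M22 = T \o sqrtop A)
       <-> M22 = 0)
    /\ (M22 = 0 <-> adj N12 \o N12 = schur H1 H2 B).
Proof.
have [psdA _] := hA; have [psdB _] := hB.
have [_ P0] := (@sqrtopP _ _ A psdA).
split.
  apply/seteqP; split=> M /=.
    move=> [[/compact_bounded_op bM MB] psdPM].
    exact: (solution_of_green psdA psdB hH1 hH2 bM MB psdPM).
  move=> [N [M22 [adm ->]]]; have [bN _ _ bM22 _] := adm.
  split; last exact: psd_sqrt_solution.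
  apply: green_compact => //; first exact: bounded_solution.
  exact: solution_sqr.
move=> N M22 adm; have [bN _ _ bM22 MM] := adm.
have bM := bounded_solution psdA psdB hH1 hH2 bN bM22.
have lM := bounded_lin bM; set M := solution A B N M22 in bM lM *.
have psdP := psd_sqrtop psdA; have lP := bounded_lin (psd_bounded psdP).
split.
- split=> [[T [[linT _ _ _] MT]]|M220].
    rewrite -(solution_block22 psdA psdB hH1 hH2 bN bM22) -/M MT.
    (* Linearity is only assumed on range A^(1/2), which contains 0; the M22 block evaluates T at
       A^(1/2) v = 0. *)
    have T0 : T 0 = 0.
      have R0 : range (sqrtop A) 0 by exists 0 => //; exact: (lin0 lP).
      have := linT 1 0 0 R0 R0; rewrite !scale1r addr0 => /eqP.
      by rewrite eq_sym -subr_eq0 addrK => /eqP.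
    apply/funext => v; rewrite /block /= (null_sqrt_val psdA hH2) T0.
    exact: (lin0 (bounded_lin (bounded_oproj H2))).
  (* With M22 = 0 the operator M vanishes on H2, the null space of A^(1/2), so M x depends only on
     A^(1/2) x and T is well defined on the range. *)
  have Mker x y : sqrtop A x = sqrtop A y -> M x = M y.
    move=> xy; apply/eqP; rewrite -subr_eq0 -(linB lM); apply/eqP.
    have Axy : carrier H2 (x - y).
      by rewrite hH2; apply/(sqrtop_eq0 _ psdA); rewrite (linB lP) xy subrr.
    pose v : H2 := exist _ (x - y) (mem_set Axy).
    by rewrite /M M220; exact: (solution_null psdA psdB hH1 hH2 v bN).
  pose T y := xget 0 [set z | exists2 x, sqrtop A x = y & M x = z].
  have TP : T \o sqrtop A = M.
    apply/funext => x /=; apply: xget_subset1; first by exists x.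
    by move=> _ _ [u uy <-] [v vy <-]; apply: Mker; rewrite uy vy.
  exists T; split=> //; apply: (optimal_prepushforward_factor hA hB bM) => //.
  + exact: solution_sqr.
  + exact: psd_sqrt_solution.
  + move=> a _ _ [u _ <-] [v _ <-]; rewrite -lP.
    by rewrite -[T _]/((T \o sqrtop A) _) TP lM -TP.
- split=> [M220|NN].
    apply/esym/eqP; rewrite -subr_eq0; apply/eqP; rewrite -MM M220.
    by apply/funext.
  by apply: adj_comp_eq0 => //; rewrite MM NN subrr.
Qed.
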